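(* Let $A$ and $B$ be two finite dimensional $k$-algebras and $\Lambda:=A\otimes_k B$. Then $\mathsf{Mon}(B, A\text{-}\mathsf{Gproj})\subseteq\Lambda\text{-}\mathsf{Gproj}$.
   Context: $k$ is a fixed field; all algebras are finite dimensional $k$-algebras; $\otimes=\otimes_k$; modules are finitely generated left modules unless stated otherwise. $D=\mathrm{Hom}_k(-,k)$. A $\Gamma$-module $G$ is Gorenstein projective if there is an exact complex $P^\bullet=(\cdots\to P^{i}\xrightarrow{d^i}P^{i+1}\to\cdots)$ of finitely generated projective $\Gamma$-modules with $G=\mathrm{Ker}\,d^1$ such that $\mathrm{Hom}_\Gamma(P^\bullet,{}_\Gamma\Gamma)$ is exact; $\Gamma\text{-}\mathsf{Gproj}$ is the full subcategory of $\Gamma\text{-mod}$ of Gorenstein projective modules. $\mathsf{Mon}(B,A)$ is the full subcategory of $\Lambda\text{-mod}$ consisting of the modules $X$ with $\mathrm{Tor}_i^{\Lambda}(A\otimes D(S),X)=0$ for all $i\ge 1$ and all simple left $B$-modules $S$. For a full additive subcategory $\mathscr{L}$ of $A\text{-mod}$, $\mathsf{Mon}(B,\mathscr{L})$ is the full subcategory of those $X\in\mathsf{Mon}(B,A)$ such that the left $A$-module $(A\otimes V)\otimes_\Lambda X$ lies in $\mathscr{L}$ for every finitely generated right $B$-module $V$. *)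

(* Defs.v *)
From HB Require Import structures.
From mathcomp Require Import all_boot all_order all_algebra all_field.
From mathcomp Require Import generic_quotient boolp.

Set Implicit Arguments.
Unset Strict Implicit.
Unset Printing Implicit Defensive.

Import GRing.Theory.

Local Open Scope ring_scope.
Local Open Scope quotient_scope.

(* The tensor product of two abelian groups, balanced over an arbitrary       *)
(* family R of right operators on M and left operators on N.  It is the       *)
(* commutative monoid presented by the symbols m (x) n: formal sums are       *)
(* sequences of pairs, and tens_eq is the congruence generated by the bilinear*)
(* and balancing relations. Opposites exist because of the rule tens_eq0:     *)
(* m (x) n + (- m) (x) n = 0 (x) n = 0.                                       *)
Section Tensor.

Variables (R : Type) (M N : zmodType) (ra : M -> R -> M) (la : R -> N -> N).

Inductive tens_eq : seq (M * N) -> seq (M * N) -> Prop :=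
| tens_eq_refl s : tens_eq s s
| tens_eq_sym s t : tens_eq s t -> tens_eq t s
| tens_eq_trans s t u : tens_eq s t -> tens_eq t u -> tens_eq s u
| tens_eq_cat s s' t t' :
    tens_eq s s' -> tens_eq t t' -> tens_eq (s ++ t) (s' ++ t')
| tens_eqC s t : tens_eq (s ++ t) (t ++ s)
| tens_eq0 n : tens_eq [:: (0, n)] [::]
| tens_eqDl m m' n : tens_eq [:: (m + m', n)] [:: (m, n); (m', n)]
| tens_eqDr m n n' : tens_eq [:: (m, n + n')] [:: (m, n); (m, n')]
| tens_eq_bal m r n : tens_eq [:: (ra m r, n)] [:: (m, la r n)].

Definition tens_eqb : rel (seq (M * N)) := fun s t => `[< tens_eq s t >].

Lemma tens_eqb_equiv : equiv_class_of tens_eqb.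
Proof.
split=> [s|s t|t s u].
- exact/asboolP/tens_eq_refl.
- by apply/asboolP/asboolP; apply: tens_eq_sym.
- by move=> /asboolP st /asboolP tu; apply/asboolP; apply: tens_eq_trans tu.
Qed.

Canonical tens_equiv := EquivRelPack tens_eqb_equiv.

Definition tens := {eq_quot tens_equiv}.

HB.instance Definition _ := Choice.on tens.
HB.instance Definition _ := EqQuotient.on tens.

Lemma tens_eqP s t : tens_eq s t <-> \pi_tens s = \pi_tens t.
Proof.
split=> [st|/eqmodP/asboolP//].
by apply/eqmodP/asboolP.
Qed.

Lemma tens_eq_repr s : tens_eq (repr (\pi_tens s)) s.
Proof. by apply/tens_eqP; rewrite reprK. Qed.

Definition tens_zero : tens := \pi_tens [::].
Definition tens_add (x y : tens) : tens := \pi_tens (repr x ++ repr y).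
Definition tens_opp (x : tens) : tens :=
  \pi_tens [seq (- p.1, p.2) | p <- repr x].

Lemma tens_addE s t :
  tens_add (\pi_tens s) (\pi_tens t) = \pi_tens (s ++ t).
Proof. by apply/tens_eqP; apply: tens_eq_cat; apply: tens_eq_repr. Qed.

Fact tens_addA : associative tens_add.
Proof.
move=> x y z; elim/quotW: x => s; elim/quotW: y => t; elim/quotW: z => u.
by rewrite (tens_addE t u) (tens_addE s t) (tens_addE s) (tens_addE _ u) catA.
Qed.

Fact tens_addC : commutative tens_add.
Proof. by move=> x y; apply/tens_eqP/tens_eqC. Qed.

Fact tens_add0 : left_id tens_zero tens_add.
Proof. by move=> x; elim/quotW: x => s; apply: tens_addE. Qed.

Fact tens_addN : left_inverse tens_zero tens_opp tens_add.
Proof.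
move=> x; rewrite -{2}[x]reprK (tens_addE _ (repr x)); apply/tens_eqP.
elim: (repr x) => [|[m n] s IHs] /=; first exact: tens_eq_refl.
set t := [seq _ | _ <- s] in IHs *.
have H : tens_eq ([:: (- m, n)] ++ (t ++ [:: (m, n)]) ++ s)
                 (([:: (- m, n)] ++ [:: (m, n)]) ++ (t ++ s)).
  rewrite -[X in tens_eq _ X]catA.
  apply: tens_eq_cat; first exact: tens_eq_refl.
  rewrite [X in tens_eq _ X]catA.
  by apply: tens_eq_cat; [apply: tens_eqC | apply: tens_eq_refl].
have -> : (- m, n) :: t ++ (m, n) :: s =
          [:: (- m, n)] ++ (t ++ [:: (m, n)]) ++ s by rewrite -catA.
apply: tens_eq_trans H _; rewrite -[[::]]cats0.
apply: tens_eq_cat => //.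
apply: tens_eq_trans (tens_eq0 n); rewrite -[0](addNr m).
exact/tens_eq_sym/tens_eqDl.
Qed.

HB.instance Definition _ := GRing.isZmodule.Build tens
  tens_addA tens_addC tens_add0 tens_addN.

Definition pure (m : M) (n : N) : tens := \pi_tens [:: (m, n)].

Lemma pureDl m m' n : pure (m + m') n = pure m n + pure m' n.
Proof. by rewrite [RHS]tens_addE; apply/tens_eqP/tens_eqDl. Qed.

Lemma pureDr m n n' : pure m (n + n') = pure m n + pure m n'.
Proof. by rewrite [RHS]tens_addE; apply/tens_eqP/tens_eqDr. Qed.

Lemma pure_bal m r n : pure (ra m r) n = pure m (la r n).
Proof. exact/tens_eqP/tens_eq_bal. Qed.

Lemma tens_sum s : \pi_tens s = \sum_(p <- s) pure p.1 p.2.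
Proof.
elim: s => [|[m n] s IHs]; first by rewrite big_nil.
by rewrite big_cons -IHs [RHS]tens_addE.
Qed.

Lemma tens_ind (P : tens -> Prop) :
  P 0 -> (forall x y, P x -> P y -> P (x + y)) ->
  (forall m n, P (pure m n)) -> forall x, P x.
Proof.
move=> P0 PD Pp x; rewrite -[x]reprK tens_sum.
by elim: (repr x) => [|p s IHs]; rewrite ?big_nil ?big_cons //; apply: PD.
Qed.

Definition balanced (G : zmodType) (f : M -> N -> G) : Prop :=
  [/\ forall m m' n, f (m + m') n = f m n + f m' n,
      forall m n n', f m (n + n') = f m n + f m n'
    & forall m r n, f (ra m r) n = f m (la r n)].

(* The additive map out of the tensor product induced by f; meaningful only   *)
(* when f is balanced.                                                        *)
Definition tens_lift (G : zmodType) (f : M -> N -> G) (x : tens) : G :=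
  \sum_(p <- repr x) f p.1 p.2.

Section Lift.
Variables (G : zmodType) (f : M -> N -> G).
Hypothesis fP : balanced f.

Lemma tens_lift_pi s : tens_lift f (\pi_tens s) = \sum_(p <- s) f p.1 p.2.
Proof.
case: fP => fDl fDr fb.
have f0 n : f 0 n = 0 by apply: (addrI (f 0 n)); rewrite -fDl !addr0.
rewrite /tens_lift; have := tens_eq_repr s; move: (repr _) => r; elim=> //=.
- by move=> {}s t u _ -> _ ->.
- by move=> {}s s' t t' _ es _ et; rewrite !big_cat es et.
- by move=> {}s t; rewrite !big_cat /= addrC.
- by move=> n; rewrite big_seq1 big_nil f0.
- by move=> m m' n; rewrite big_seq1 big_cons big_seq1 fDl.
- by move=> m n n'; rewrite big_seq1 big_cons big_seq1 fDr.
- by move=> m c n; rewrite !big_seq1 fb.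
Qed.

Lemma tens_lift_pure m n : tens_lift f (pure m n) = f m n.
Proof. by rewrite tens_lift_pi big_seq1. Qed.

Lemma tens_liftD x y : tens_lift f (x + y) = tens_lift f x + tens_lift f y.
Proof.
by rewrite -[x]reprK -[y]reprK [\pi_tens _ + _]tens_addE !tens_lift_pi big_cat.
Qed.

Lemma tens_lift0 : tens_lift f 0 = 0.
Proof. by rewrite [0 in LHS]/0 /= /tens_zero tens_lift_pi big_nil. Qed.

End Lift.

Lemma tens_lift_addf (G : zmodType) (f g h : M -> N -> G) x :
  (forall m n, h m n = f m n + g m n) ->
  tens_lift h x = tens_lift f x + tens_lift g x.
Proof. by move=> hE; rewrite -big_split; apply: eq_bigr => p _; apply: hE. Qed.

Lemma eq_tens_lift (G : zmodType) (f g : M -> N -> G) x :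
  (forall m n, f m n = g m n) -> tens_lift f x = tens_lift g x.
Proof. by move=> fg; apply: eq_bigr => p _; apply: fg. Qed.

End Tensor.

Arguments pure {R M N ra la}.
Arguments tens_lift {R M N ra la G}.

(* g (x) h, meaningful when g and h are additive and commute with operators.  *)
Definition tens_map (R : Type) (M N M' N' : zmodType)
    (ra : M -> R -> M) (la : R -> N -> N)
    (ra' : M' -> R -> M') (la' : R -> N' -> N')
    (g : M -> M') (h : N -> N') (x : tens ra la) : tens ra' la' :=
  tens_lift (fun m n => pure (g m) (h n)) x.

Arguments tens_map {R M N M' N' ra la ra' la'} g h x.

Section TensorAlgebra.

Variables (k : fieldType) (A B : falgType k).

Definition tensalg : Type :=
  tens (fun (a : A) (c : k) => c *: a) (fun (c : k) (b : B) => c *: b).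

HB.instance Definition _ := GRing.Zmodule.on tensalg.

Definition ta_pure (a : A) (b : B) : tensalg := pure a b.

Definition ta_mulp (y : tensalg) (a : A) (b : B) : tensalg :=
  tens_lift (fun a' b' => ta_pure (a * a') (b * b')) y.

Definition ta_mul (x y : tensalg) : tensalg := tens_lift (ta_mulp y) x.

Lemma ta_pureZ a c b : ta_pure (c *: a) b = ta_pure a (c *: b).
Proof. exact: pure_bal. Qed.

Let ta_mulp_bal1 a b : balanced (fun (a : A) (c : k) => c *: a)
  (fun (c : k) (b : B) => c *: b) (fun a' b' => ta_pure (a * a') (b * b')).
Proof.
split=> [m m' n|m n n'|m r n]; rewrite ?mulrDr.
- exact: pureDl.
- exact: pureDr.
- by rewrite -!scalerAr; apply: pure_bal.
Qed.

Let ta_mulp_bal2 y : balanced (fun (a : A) (c : k) => c *: a)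
  (fun (c : k) (b : B) => c *: b) (ta_mulp y).
Proof.
split=> [m m' n|m n n'|m r n].
- by apply: tens_lift_addf => u v; rewrite mulrDl; apply: pureDl.
- by apply: tens_lift_addf => u v; rewrite mulrDl; apply: pureDr.
- by apply: eq_tens_lift => u v; rewrite -!scalerAl; apply: pure_bal.
Qed.

Lemma ta_mul_pure a b a' b' :
  ta_mul (ta_pure a b) (ta_pure a' b') = ta_pure (a * a') (b * b').
Proof. by rewrite /ta_mul tens_lift_pure // /ta_mulp tens_lift_pure. Qed.

Fact ta_mulDl : left_distributive ta_mul +%R.
Proof. by move=> x y z; rewrite /ta_mul tens_liftD. Qed.

Fact ta_mulDr : right_distributive ta_mul +%R.
Proof.
by move=> x y z; apply: tens_lift_addf => a b; rewrite /ta_mulp tens_liftD.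
Qed.

Let ta_mul0l x : ta_mul 0 x = 0.
Proof. by apply: (addrI (ta_mul 0 x)); rewrite -ta_mulDl !addr0. Qed.

Let ta_mul0r x : ta_mul x 0 = 0.
Proof. by apply: (addrI (ta_mul x 0)); rewrite -ta_mulDr !addr0. Qed.

Fact ta_mulA : associative ta_mul.
Proof.
move=> x y z.
elim/tens_ind: x => [|x x' IHx IHx'|a b]; first by rewrite !ta_mul0l.
  by rewrite !ta_mulDl IHx IHx'.
elim/tens_ind: y => [|y y' IHy IHy'|a' b'].
- by rewrite ta_mul0l !ta_mul0r ta_mul0l.
- by rewrite ta_mulDr !ta_mulDl ta_mulDr IHy IHy'.
elim/tens_ind: z => [|z z' IHz IHz'|a'' b'']; first by rewrite !ta_mul0r.
  by rewrite !ta_mulDr IHz IHz'.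
by rewrite -!/(ta_pure _ _) !ta_mul_pure !mulrA.
Qed.

Fact ta_mul1l : left_id (ta_pure 1 1) ta_mul.
Proof.
elim/tens_ind=> [|x y IHx IHy|a b]; first by rewrite ta_mul0r.
  by rewrite ta_mulDr IHx IHy.
by rewrite -!/(ta_pure _ _) ta_mul_pure !mul1r.
Qed.

Fact ta_mul1r : right_id (ta_pure 1 1) ta_mul.
Proof.
elim/tens_ind=> [|x y IHx IHy|a b]; first by rewrite ta_mul0l.
  by rewrite ta_mulDl IHx IHy.
by rewrite -!/(ta_pure _ _) ta_mul_pure !mulr1.
Qed.

Fact ta_oner_neq0 : ta_pure 1 1 != 0.
Proof.
pose phi (C : falgType k) (x : C) i := coord (vbasis {:C}) i x.
have phi1 (C : falgType k) : exists i, @phi C 1 i != 0.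
  apply/existsP; apply: contraT; rewrite negb_exists => /forallP z.
  have := oner_neq0 C; rewrite (coord_vbasis (memvf (1 : C))) big1 ?eqxx // => i _.
  by move/negPn: (z i) => /eqP; rewrite /phi => ->; rewrite scale0r.
have [[i ui] [j vj]] := (phi1 A, phi1 B).
pose f (a : A) (b : B) := phi A a i * phi B b j.
have fP : balanced (fun (a : A) (c : k) => c *: a)
  (fun (c : k) (b : B) => c *: b) f.
  split=> [m m' n|m n n'|m r n]; rewrite /f /phi ?linearD ?linearZ /=.
  - by rewrite mulrDl.
  - by rewrite mulrDr.
  - by rewrite mulrCA mulrA.
apply/eqP => /(congr1 (tens_lift f)).
by rewrite tens_lift_pure // tens_lift0 // => /eqP; rewrite mulf_eq0 (negPf ui) (negPf vj).
Qed.

HB.instance Definition _ := GRing.Zmodule_isNzRing.Build tensalg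
  ta_mulA ta_mul1l ta_mul1r ta_mulDl ta_mulDr ta_oner_neq0.

End TensorAlgebra.

Notation "A ⊗ B" := (tensalg A B) (at level 40, left associativity).

(* Right modules over R are left modules over the converse ring R^c.          *)

Definition tensmod (R : pzRingType) (M : lmodType R^c) (N : lmodType R) : Type :=
  tens (fun (m : M) (r : R) => (r : R^c) *: m) (fun (r : R) (n : N) => r *: n).

HB.instance Definition _ (R : pzRingType) (M : lmodType R^c) (N : lmodType R) :=
  GRing.Zmodule.on (tensmod M N).

Definition tensmod_map (R : pzRingType) (M : lmodType R^c) (N N' : lmodType R)
    (h : {linear N -> N'}) : tensmod M N -> tensmod M N' :=
  tens_map id h.

Arguments tensmod_map {R} M {N N'} h.

Definition exact_at (U V W : zmodType) (f : U -> V) (g : V -> W) : Prop :=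
  forall y, g y = 0 <-> exists x, f x = y.

Section Modules.

Variable R : pzRingType.

Definition fin_gen (M : lmodType R) : Prop :=
  exists (n : nat) (g : 'I_n -> M),
    forall m : M, exists c : 'I_n -> R, m = \sum_i c i *: g i.

Definition simple_module (S : lmodType R) : Prop :=
  (exists s : S, s != 0) /\
  (forall U : {pred S}, GRing.submod_closed U ->
     (forall s, s \in U -> s = 0) \/ (forall s, s \in U)).

Definition projective_module (P : lmodType R) : Prop :=
  forall (M N : lmodType R) (g : {linear M -> N}) (f : {linear P -> N}),
    (forall y, exists x, g x = y) ->
    exists h : {linear P -> M}, forall x, g (h x) = f x.

Definition projective_resolution (X : lmodType R) (P : nat -> lmodType R)
    (d : forall n, {linear P n.+1 -> P n}) (eps : {linear P 0 -> X}) : Prop :=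
  [/\ forall n, projective_module (P n),
      forall x, exists p, eps p = x,
      exact_at (d 0) eps
    & forall n, exact_at (d n.+1) (d n)].

(* Tor_i^R(M, X) = 0: the complex M (x)_R P, where M (x)_R P_0 is followed by *)
(* 0, is exact at its i-th term for every projective resolution P of X.  This *)
(* does not depend on P, so that quantifying over all P is only a convenience.*)
Definition Tor_vanishes (i : nat) (M : lmodType R^c) (X : lmodType R) : Prop :=
  forall (P : nat -> lmodType R) (d : forall n, {linear P n.+1 -> P n})
         (eps : {linear P 0 -> X}),
    projective_resolution d eps ->
    match i with
    | 0 => forall y : tensmod M (P 0), exists x, tensmod_map M (d 0) x = y
    | j.+1 => exact_at (tensmod_map M (d j.+1)) (tensmod_map M (d j))
    end.

Definition Gproj (G : lmodType R) : Prop :=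
  fin_gen G /\
  exists (P : int -> lmodType R) (d : forall i, {linear P i -> P (i + 1)}),
    [/\ forall i, fin_gen (P i) /\ projective_module (P i),
        forall i, exact_at (d i) (d (i + 1)),
        (* exactness of Hom_R(P, R) at Hom_R(P (i + 1), R) *)
        forall i (f : {linear P (i + 1) -> R^o}),
          (forall x, f (d i x) = 0) <->
          exists g : {linear P (i + 1 + 1) -> R^o},
            forall x, g (d (i + 1) x) = f x
      & exists iota : {linear G -> P 1}, injective iota /\ exact_at iota (d 1)].

End Modules.

(* D(S) = Hom_k(S, k) for a left B-module S, k acting on S through B.         *)
Section Dual.

Variables (k : fieldType) (B : falgType k) (S : lmodType B).

Definition klinear (f : S -> k) : Prop :=
  (forall s t, f (s + t) = f s + f t) /\
  (forall (c : k) s, f (c%:A *: s) = c * f s).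

Record dualmod : Type :=
  Dualmod { dual_fun :> S -> k; dual_funP : `[< klinear dual_fun >] }.

HB.instance Definition _ := [isSub for dual_fun].
HB.instance Definition _ := gen_eqMixin dualmod.
HB.instance Definition _ := gen_choiceMixin dualmod.

Lemma dual_eqP (f g : dualmod) : (forall s, f s = g s) -> f = g.
Proof. by move=> fg; apply: val_inj; apply: funext. Qed.

Lemma dualD (f : dualmod) s t : f (s + t) = f s + f t.
Proof. by case: f => f /= /asboolP[]. Qed.

Lemma dualZ (f : dualmod) (c : k) s : f (c%:A *: s) = c * f s.
Proof. by case: f => f /= /asboolP[]. Qed.

Fact dual_zero_subproof : `[< klinear (fun=> 0) >].
Proof. by apply/asboolP; split=> *; rewrite ?addr0 ?mulr0. Qed.
Definition dual_zero := Dualmod dual_zero_subproof.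

Fact dual_add_subproof (f g : dualmod) : `[< klinear (fun s => f s + g s) >].
Proof.
by apply/asboolP; split=> *; rewrite ?dualD ?dualZ ?mulrDr // addrACA.
Qed.
Definition dual_add f g := Dualmod (dual_add_subproof f g).

Fact dual_opp_subproof (f : dualmod) : `[< klinear (fun s => - f s) >].
Proof.
by apply/asboolP; split=> *; rewrite ?dualD ?dualZ ?opprD // mulrN.
Qed.
Definition dual_opp f := Dualmod (dual_opp_subproof f).

Fact dual_addA : associative dual_add.
Proof. by move=> f g h; apply: dual_eqP => s /=; rewrite addrA. Qed.
Fact dual_addC : commutative dual_add.
Proof. by move=> f g; apply: dual_eqP => s /=; rewrite addrC. Qed.
Fact dual_add0 : left_id dual_zero dual_add.
Proof. by move=> f; apply: dual_eqP => s /=; rewrite add0r. Qed.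
Fact dual_addN : left_inverse dual_zero dual_opp dual_add.
Proof. by move=> f; apply: dual_eqP => s /=; rewrite addNr. Qed.

HB.instance Definition _ := GRing.isZmodule.Build dualmod
  dual_addA dual_addC dual_add0 dual_addN.

Fact dual_scale_subproof (b : B) (f : dualmod) :
  `[< klinear (fun s => f (b *: s)) >].
Proof.
apply/asboolP; split=> [s t|c s]; first by rewrite scalerDr dualD.
by rewrite -dualZ !scalerA -scalerAl mul1r -scalerAr mulr1.
Qed.
Definition dual_scale (b : B^c) f := Dualmod (dual_scale_subproof b f).

Fact dual_scaleA (b c : B^c) f :
  dual_scale b (dual_scale c f) = dual_scale (b * c) f.
Proof. by apply: dual_eqP => s /=; rewrite scalerA. Qed.
Fact dual_scale1 : left_id (1 : B^c) dual_scale.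
Proof. by move=> f; apply: dual_eqP => s /=; rewrite scale1r. Qed.
Fact dual_scaleDr : right_distributive dual_scale +%R.
Proof. by move=> b f g; apply: dual_eqP. Qed.
Fact dual_scaleDl f : {morph dual_scale^~ f : b c / b + c}.
Proof. by move=> b c; apply: dual_eqP => s /=; rewrite scalerDl dualD. Qed.

HB.instance Definition _ := GRing.Zmodule_isLmodule.Build (B^c : pzRingType)
  dualmod dual_scaleA dual_scale1 dual_scaleDr dual_scaleDl.

End Dual.

(* The A-(A ⊗ B)-bimodule A (x)_k V, for a right B-module V, with             *)
(* (a (x) v) (a' (x) b) = a a' (x) v b.  The canonical module structure is    *)
(* the right one; AV_lmul is the left action of A.                            *)
Section AtensV.

Variables (k : fieldType) (A B : falgType k) (V : lmodType B^c).

Definition AtensV : Type :=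
  tens (fun (a : A) (c : k) => c *: a)
       (fun (c : k) (v : V) => (c%:A : B^c) *: v).

HB.instance Definition _ := GRing.Zmodule.on AtensV.

Definition AV_pure (a : A) (v : V) : AtensV := pure a v.

Definition AV_actp (t : AtensV) (a : A) (b : B) : AtensV :=
  tens_lift (fun a' v => AV_pure (a' * a) ((b : B^c) *: v)) t.

Definition AV_act (x : (A ⊗ B)^c) (t : AtensV) : AtensV :=
  tens_lift (AV_actp t) (x : A ⊗ B).

Definition AV_lmul (a : A) (t : AtensV) : AtensV :=
  tens_lift (fun a' v => AV_pure (a * a') v) t.

Let raA (a : A) (c : k) := c *: a.
Let laV (c : k) (v : V) := (c%:A : B^c) *: v.

Let AV_actp_bal1 a b :
  balanced raA laV (fun a' v => AV_pure (a' * a) ((b : B^c) *: v)).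
Proof.
split=> [m m' n|m n n'|m c n].
- by rewrite mulrDl; apply: pureDl.
- by rewrite scalerDr; apply: pureDr.
- rewrite /raA /laV -scalerAl !scalerA.
  have -> : (b : B^c) * (c%:A : B^c) = (c%:A : B^c) * (b : B^c).
    by rewrite /GRing.mul /= -scalerAl mul1r -scalerAr mulr1.
  by rewrite -scalerA; apply: pure_bal.
Qed.

Let AV_actp_bal2 t : balanced (fun (a : A) (c : k) => c *: a)
  (fun (c : k) (b : B) => c *: b) (AV_actp t).
Proof.
split=> [m m' n|m n n'|m r n].
- by apply: tens_lift_addf => u v; rewrite mulrDr; apply: pureDl.
- by apply: tens_lift_addf => u v; rewrite scalerDl; apply: pureDr.
- apply: eq_tens_lift => u v; rewrite -scalerAr.
  have -> : (r *: n : B^c) = (r%:A : B^c) * (n : B^c).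
    by rewrite /GRing.mul /= -scalerAr mulr1.
  by rewrite -scalerA; apply: pure_bal.
Qed.

Let AV_lmul_bal a : balanced raA laV (fun a' v => AV_pure (a * a') v).
Proof.
split=> [m m' n|m n n'|m c n].
- by rewrite mulrDr; apply: pureDl.
- exact: pureDr.
- by rewrite /raA -scalerAr; apply: pure_bal.
Qed.

Lemma AV_act_pure (a' : A) (b : B) (a : A) (v : V) :
  AV_act (ta_pure a' b) (AV_pure a v) = AV_pure (a * a') ((b : B^c) *: v).
Proof.
rewrite /AV_act [LHS](tens_lift_pure (AV_actp_bal2 _)).
exact: (tens_lift_pure (AV_actp_bal1 _ _)).
Qed.

Lemma AV_lmul_pure (a a' : A) (v : V) :
  AV_lmul a (AV_pure a' v) = AV_pure (a * a') v.
Proof. exact: (tens_lift_pure (AV_lmul_bal _)). Qed.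

Fact AV_actDr : right_distributive AV_act +%R.
Proof.
move=> x t u; apply: tens_lift_addf => a b.
exact: (tens_liftD (AV_actp_bal1 _ _)).
Qed.

Fact AV_actDl t : {morph AV_act^~ t : x y / x + y}.
Proof. by move=> x y; apply: (tens_liftD (AV_actp_bal2 _)). Qed.

Let AV_act0l t : AV_act 0 t = 0.
Proof. by apply: (addrI (AV_act 0 t)); rewrite -AV_actDl !addr0. Qed.

Let AV_act0r x : AV_act x 0 = 0.
Proof. by apply: (addrI (AV_act x 0)); rewrite -AV_actDr !addr0. Qed.

Fact AV_actA (x y : (A ⊗ B)^c) t : AV_act x (AV_act y t) = AV_act (x * y) t.
Proof.
elim/tens_ind: t => [|t u IHt IHu|a v]; first by rewrite !AV_act0r.
  by rewrite !AV_actDr IHt IHu.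
elim/tens_ind: x => [|x x' IHx IHx'|a' b']; first by rewrite mul0r !AV_act0l.
  by rewrite mulrDl !AV_actDl IHx IHx'.
elim/tens_ind: y => [|y y' IHy IHy'|a'' b''].
- by rewrite mulr0 !AV_act0l AV_act0r.
- by rewrite mulrDr !AV_actDl AV_actDr IHy IHy'.
rewrite -!/(ta_pure _ _) -/(AV_pure _ _) !AV_act_pure.
have -> : (ta_pure a' b' : (A ⊗ B)^c) * (ta_pure a'' b'' : (A ⊗ B)^c) =
          ta_pure (a'' * a') (b'' * b') by exact: ta_mul_pure.
by rewrite AV_act_pure mulrA scalerA.
Qed.

Fact AV_act1 : left_id (1 : (A ⊗ B)^c) AV_act.
Proof.
elim/tens_ind=> [|t u IHt IHu|a v]; first by rewrite AV_act0r.
  by rewrite AV_actDr IHt IHu.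
by rewrite -/(AV_pure _ _) [LHS]AV_act_pure mulr1 scale1r.
Qed.

HB.instance Definition _ := GRing.Zmodule_isLmodule.Build
  ((A ⊗ B)^c : pzRingType) AtensV AV_actA AV_act1 AV_actDr AV_actDl.

Lemma AV_lmulDr a : {morph AV_lmul a : t u / t + u}.
Proof. by move=> t u; apply: (tens_liftD (AV_lmul_bal _)). Qed.

Lemma AV_lmulDl t : {morph AV_lmul^~ t : a b / a + b}.
Proof.
by move=> a b; apply: tens_lift_addf => a' v; rewrite mulrDl; apply: pureDl.
Qed.

Let AV_lmul0 a : AV_lmul a 0 = 0.
Proof. by apply: (addrI (AV_lmul a 0)); rewrite -AV_lmulDr !addr0. Qed.

Lemma AV_lmulA a b t : AV_lmul a (AV_lmul b t) = AV_lmul (a * b) t.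
Proof.
elim/tens_ind: t => [|t u IHt IHu|a' v]; first by rewrite !AV_lmul0.
  by rewrite !AV_lmulDr IHt IHu.
by rewrite -/(AV_pure _ _) !AV_lmul_pure mulrA.
Qed.

Lemma AV_lmul1 t : AV_lmul 1 t = t.
Proof.
elim/tens_ind: t => [|t u IHt IHu|a' v]; first by rewrite !AV_lmul0.
  by rewrite !AV_lmulDr IHt IHu.
by rewrite -/(AV_pure _ _) !AV_lmul_pure mul1r.
Qed.

Lemma AV_lmul_act a (x : (A ⊗ B)^c) (t : AtensV) :
  AV_lmul a (x *: t) = x *: AV_lmul a t.
Proof.
elim/tens_ind: t => [|t u IHt IHu|a' v]; first by rewrite !(scaler0, AV_lmul0).
  by rewrite !(scalerDr, AV_lmulDr) IHt IHu.
elim/tens_ind: x => [|x y IHx IHy|a'' b].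
- by rewrite !scale0r AV_lmul0.
- by rewrite !scalerDl AV_lmulDr IHx IHy.
rewrite -/(ta_pure _ _) -/(AV_pure _ _) !AV_lmul_pure.
by rewrite /GRing.scale /= !AV_act_pure AV_lmul_pure mulrA.
Qed.

End AtensV.

Arguments AtensV {k} A {B} V.

(* The left A-module (A (x)_k V) (x)_(A ⊗ B) X.                               *)
Section AVX.

Variables (k : fieldType) (A B : falgType k) (V : lmodType B^c).
Variable X : lmodType (A ⊗ B).

Definition AtensV_tens : Type := tensmod (AtensV A V) X.

HB.instance Definition _ := GRing.Zmodule.on AtensV_tens.

Definition AVX_pure (t : AtensV A V) (x : X) : AtensV_tens := pure t x.

Definition AVX_scale (a : A) (y : AtensV_tens) : AtensV_tens :=
  tens_lift (fun t x => AVX_pure (AV_lmul a t) x) y.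

Let AVX_bal a : balanced
  (fun (t : AtensV A V) (r : A ⊗ B) => (r : (A ⊗ B)^c) *: t)
  (fun (r : A ⊗ B) (x : X) => r *: x) (fun t x => AVX_pure (AV_lmul a t) x).
Proof.
split=> [t u x|t x y|t r x].
- by rewrite AV_lmulDr; apply: pureDl.
- exact: pureDr.
- by rewrite AV_lmul_act; apply: pure_bal.
Qed.

Lemma AVX_scale_pure a t x :
  AVX_scale a (AVX_pure t x) = AVX_pure (AV_lmul a t) x.
Proof. exact: (tens_lift_pure (AVX_bal a)). Qed.

Fact AVX_scaleDr : right_distributive AVX_scale +%R.
Proof. by move=> a y z; apply: (tens_liftD (AVX_bal a)). Qed.

Fact AVX_scaleDl y : {morph AVX_scale^~ y : a b / a + b}.
Proof.
by move=> a b; apply: tens_lift_addf => t x; rewrite AV_lmulDl; apply: pureDl.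
Qed.

Let AVX_scale0 a : AVX_scale a 0 = 0.
Proof. by apply: (addrI (AVX_scale a 0)); rewrite -AVX_scaleDr !addr0. Qed.

Fact AVX_scaleA a b y : AVX_scale a (AVX_scale b y) = AVX_scale (a * b) y.
Proof.
elim/tens_ind: y => [|y z IHy IHz|t x]; first by rewrite !AVX_scale0.
  by rewrite !AVX_scaleDr IHy IHz.
by rewrite -/(AVX_pure _ _) !AVX_scale_pure AV_lmulA.
Qed.

Fact AVX_scale1 : left_id 1 AVX_scale.
Proof.
elim/tens_ind=> [|y z IHy IHz|t x]; first by rewrite !AVX_scale0.
  by rewrite !AVX_scaleDr IHy IHz.
by rewrite -/(AVX_pure _ _) !AVX_scale_pure AV_lmul1.
Qed.

HB.instance Definition _ := GRing.Zmodule_isLmodule.Build A AtensV_tens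
  AVX_scaleA AVX_scale1 AVX_scaleDr AVX_scaleDl.

End AVX.

Definition Mon (k : fieldType) (A B : falgType k) (X : lmodType (A ⊗ B)) : Prop :=
  fin_gen X /\
  forall S : lmodType B, simple_module S ->
    forall i : nat, (1 <= i)%N -> Tor_vanishes i (AtensV A (dualmod S)) X.

Definition MonL (k : fieldType) (A B : falgType k) (L : lmodType A -> Prop)
    (X : lmodType (A ⊗ B)) : Prop :=
  Mon X /\
  forall V : lmodType B^c, fin_gen V -> L (AtensV_tens V X).

(* Main.v *)
Require Import Defs.
From HB Require Import structures.
From mathcomp Require Import all_boot all_order all_algebra all_field.
From mathcomp Require Import generic_quotient boolp.

Set Implicit Arguments.
Unset Strict Implicit.
Unset Printing Implicit Defensive.

Import GRing.Theory.

Local Open Scope ring_scope.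
Local Open Scope quotient_scope.

(* Write T X = D(B) (x)_B X, an A-module. Since Hom_k(D(B), A) = A (x) B, one  *)
(* has Hom_L(X, L) = Hom_A(T X, A) for L = A (x) B, so that a map of          *)
(* L-modules extends all maps to L as soon as its image under T extends all   *)
(* maps to A. The vanishing of Tor against D(S) means, by duality over k,     *)
(* that maps of B-modules from the first syzygy of X to a simple module S     *)
(* extend to the free cover; by devissage X is then B-projective. Consider    *)
(* the X that are B-projective and such that T X is, up to projectives, a     *)
(* summand of a syzygy of a complete resolution over A. For such X, a free    *)
(* cover and a left approximation by a free L-module are B-split, so T        *)
(* preserves their exactness, and the kernel of the former and the cokernel   *)
(* of the latter lie in the same class. Splicing gives a complete resolution. *)

(** Put L = A ⊗ B and T X = D(B) ⊗_B X, an A-module realised as [AtensV_tens (dualmod BB) X]. A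
    complete resolution of X is built one step at a time, in both directions, inside a class of
    L-modules ([relative_Gproj], [Gproj_of_class]). Each step is a short exact sequence with
    finitely generated projective middle term whose left map extends all maps to L.

    This extension property can be tested after T: contraction identifies A ⊗ B with Hom_k(D(B), A),
    so that Hom_L(X, L) = Hom_A(T X, A) naturally ([hom_to_tensor], [hom_of_tensor],
    [ext_prop_tp_map]). Over A it comes from T X being, up to projectives, a summand of a syzygy of
    a complete resolution. By Schanuel's argument this stable form of Gorenstein projectivity passes
    to kernels of arbitrary covers and to cokernels of arbitrary injective approximations
    ([stable_summand_kernel], [stable_summand_cokernel]).

    T preserves exactness of the sequences that split over B ([tp_map_short_exact]), which is why
    the class also asks for B-projectivity. For the given X, the duality Hom_B(Y, S) = D(D(S) ⊗_B Y)
    turns Tor_1 = 0 into the extension of B-maps from the first syzygy to simple modules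
    ([Tor_extension]). Devissage replaces the simple module by the syzygy itself, and the free cover
    splits over B ([Tor_dual_basis]). On the right, finitely many generators of Hom_A(T X, A) give
    an approximation f of X ([free_approximation]); T f is injective, and the same duality with B in
    place of S splits f over B ([approximation_split]). *)

Section LinearMaps.

Variable R : pzRingType.

Lemma linear_mapP (U V : lmodType R) (f : U -> V) :
  linear f -> exists h : {linear U -> V}, forall x, h x = f x.
Proof.
move=> f_lin.
pose fM := GRing.isLinear.Build R U V *:%R f f_lin.
by exists (HB.pack f fM : {linear U -> V}).
Qed.

Lemma linear_lift_inj (K M N : lmodType R) (j : {linear K -> M})
    (h : {linear N -> M}) :
  injective j -> (forall x, exists y, j y = h x) ->
  exists g : {linear N -> K}, forall x, j (g x) = h x.
Proof.
move=> j_inj /choice[g gE].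
have [|g' g'E] := @linear_mapP N K g; last by exists g' => x; rewrite g'E.
by move=> c x y; apply: j_inj; rewrite linearP !gE linearP.
Qed.

Lemma linear_lift_surj (M C N : lmodType R) (e : {linear M -> C})
    (h : {linear M -> N}) :
  (forall y, exists x, e x = y) -> (forall x, e x = 0 -> h x = 0) ->
  exists g : {linear C -> N}, forall x, g (e x) = h x.
Proof.
move=> /choice[s sE] eh.
have hE x y : e x = e y -> h x = h y.
  by move=> exy; apply: subr0_eq; rewrite -linearB eh // linearB exy subrr.
have [|g gE] := @linear_mapP C N (h \o s).
  by move=> c x y /=; rewrite -linearP; apply: hE; rewrite linearP !sE.
by exists g => x; rewrite gE; apply: hE.
Qed.

End LinearMaps.

(** * Submodules, quotients, kernels and cokernels *)

Section SubModule.

Variables (R : pzRingType) (M : lmodType R) (U : {pred M}).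
Hypothesis U_closed : GRing.submod_closed U.

(** The closure proof is a parameter of the type so that the module instance can depend on it;
    [quomod_eq] follows the same pattern. *)
Definition submod_of (_ : GRing.submod_closed U) : Type := {x | x \in U}.
Local Notation K := (submod_of U_closed).

HB.instance Definition _ := [Choice of K by <:].
HB.instance Definition _ := [isSub of K for @sval _ _].
HB.instance Definition _ := GRing.SubChoice_isSubLmodule.Build R M _ K
  (GRing.submod_closed_semi U_closed).

Lemma submodule_exists : exists (N : lmodType R) (j : {linear N -> M}),
  injective j /\ forall x, x \in U <-> exists y, j y = x.
Proof.
exists (K : lmodType R), \val; split=> [|x]; first exact: val_inj.
split=> [xU|[[y yU] <-]//].
by exists (exist _ x xU).
Qed.

End SubModule.

Section QuotientModule.

Variables (R : pzRingType) (M : lmodType R) (U : {pred M}).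
Hypothesis U_closed : GRing.submod_closed U.

Let U0 : 0 \in U. Proof. by case: U_closed. Qed.
Let UP c x y : x \in U -> y \in U -> c *: x + y \in U.
Proof. by case: U_closed => _; apply. Qed.
Let UN x : x \in U -> - x \in U.
Proof. by move=> xU; rewrite -[- x]addr0 -scaleN1r UP. Qed.
Let UD x y : x \in U -> y \in U -> x + y \in U.
Proof. by move=> xU yU; rewrite -[x]scale1r UP. Qed.

Definition quomod_eq (_ : GRing.submod_closed U) : rel M :=
  fun x y => x - y \in U.
Local Notation E := (quomod_eq U_closed).

Lemma quomod_eq_equiv : equiv_class_of E.
Proof.
rewrite /quomod_eq; split=> [x|x y|y x z]; first by rewrite subrr.
  by apply/idP/idP => /UN; rewrite opprB.
by move=> xy yz; rewrite -[x](subrK y) -addrA UD.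
Qed.

Canonical quomod_equiv := EquivRelPack quomod_eq_equiv.

Definition quomod := {eq_quot quomod_equiv}.

HB.instance Definition _ := Choice.on quomod.
HB.instance Definition _ := EqQuotient.on quomod.

Lemma quomod_eqP x y : x - y \in U <-> \pi_quomod x = \pi_quomod y.
Proof. by split=> [xy|/eqmodP//]; apply/eqmodP. Qed.

Lemma quomod_repr x : repr (\pi_quomod x) - x \in U.
Proof. by apply/quomod_eqP; rewrite reprK. Qed.

Definition quomod_add (x y : quomod) := \pi_quomod (repr x + repr y).
Definition quomod_opp (x : quomod) := \pi_quomod (- repr x).
Definition quomod_scale a (x : quomod) := \pi_quomod (a *: repr x).

Lemma quomod_addE x y :
  quomod_add (\pi_quomod x) (\pi_quomod y) = \pi_quomod (x + y).
Proof. by apply/quomod_eqP; rewrite opprD addrACA UD ?quomod_repr. Qed.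

Lemma quomod_oppE x : quomod_opp (\pi_quomod x) = \pi_quomod (- x).
Proof. by apply/quomod_eqP; rewrite -opprD UN ?quomod_repr. Qed.

Lemma quomod_scaleE a x :
  quomod_scale a (\pi_quomod x) = \pi_quomod (a *: x).
Proof.
by apply/quomod_eqP; rewrite -scalerBr -[_ *: _]addr0 UP ?quomod_repr.
Qed.

Fact quomod_addA : associative quomod_add.
Proof.
move=> x y z; elim/quotW: x => x; elim/quotW: y => y; elim/quotW: z => z.
by rewrite (quomod_addE y z) (quomod_addE x y) (quomod_addE x) (quomod_addE _ z) addrA.
Qed.
Fact quomod_addC : commutative quomod_add.
Proof. by move=> x y; rewrite /quomod_add addrC. Qed.
Fact quomod_add0 : left_id (\pi_quomod 0) quomod_add.
Proof. by move=> x; elim/quotW: x => x; rewrite quomod_addE add0r. Qed.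
Fact quomod_addN : left_inverse (\pi_quomod 0) quomod_opp quomod_add.
Proof.
by move=> x; elim/quotW: x => x; rewrite quomod_oppE quomod_addE addNr.
Qed.

HB.instance Definition _ := GRing.isZmodule.Build quomod
  quomod_addA quomod_addC quomod_add0 quomod_addN.

Fact quomod_scaleA a b x :
  quomod_scale a (quomod_scale b x) = quomod_scale (a * b) x.
Proof. by elim/quotW: x => x; rewrite (quomod_scaleE b x) (quomod_scaleE a) (quomod_scaleE (a * b)) scalerA. Qed.
Fact quomod_scale1 : left_id 1 quomod_scale.
Proof. by move=> x; elim/quotW: x => x; rewrite quomod_scaleE scale1r. Qed.
Fact quomod_scaleDr : right_distributive quomod_scale +%R.
Proof.
move=> a x y; elim/quotW: x => x; elim/quotW: y => y.
by rewrite [_ + _ in LHS](quomod_addE x y) (quomod_scaleE a (x + y)) !quomod_scaleE scalerDr -quomod_addE.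
Qed.
Fact quomod_scaleDl x : {morph quomod_scale^~ x : a b / a + b}.
Proof.
by move=> a b; elim/quotW: x => x; rewrite !quomod_scaleE scalerDl -quomod_addE.
Qed.

HB.instance Definition _ := GRing.Zmodule_isLmodule.Build R quomod
  quomod_scaleA quomod_scale1 quomod_scaleDr quomod_scaleDl.

Lemma quotient_exists : exists (Q : lmodType R) (e : {linear M -> Q}),
  (forall y, exists x, e x = y) /\ forall x, e x = 0 <-> x \in U.
Proof.
have [|e eE] := @linear_mapP R M quomod \pi_quomod.
  by move=> a x y; rewrite -quomod_addE -quomod_scaleE.
exists quomod, e; split=> [y|x]; first by exists (repr y); rewrite eE reprK.
by rewrite eE -[x in X in _ <-> X]subr0 quomod_eqP.
Qed.

End QuotientModule.

Section KernelCokernel.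

Variables (R : pzRingType) (M N : lmodType R).

Lemma kernel_exists (g : {linear M -> N}) :
  exists (K : lmodType R) (j : {linear K -> M}), injective j /\ exact_at j g.
Proof.
have [|K [j [j_inj jE]]] := @submodule_exists R M [pred x | g x == 0].
  split=> [|a x y]; rewrite !inE ?linear0 // linearP => /eqP-> /eqP->.
  by rewrite scaler0 addr0.
exists K, j; split=> // x; rewrite -jE inE.
by split=> [->|/eqP].
Qed.

Lemma cokernel_exists (f : {linear M -> N}) :
  exists (C : lmodType R) (e : {linear N -> C}),
    (forall y, exists x, e x = y) /\ exact_at f e.
Proof.
have [|C [e [e_surj eE]]] := @quotient_exists R N [pred y | `[< exists x, f x = y >]].
  split=> [|a x y]; rewrite !inE; first by apply/asboolP; exists 0; rewrite linear0.
  move=> /asboolP[x' <-] /asboolP[y' <-]; apply/asboolP.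
  by exists (a *: x' + y'); rewrite linearP.
exists C, e; split=> // y; rewrite eE inE.
by split=> /asboolP.
Qed.

End KernelCokernel.

(** * Finitely generated projectives via dual bases *)

Section DualBasis.

Variable R : pzRingType.

Definition row_comb n (M : lmodType R) (p : 'I_n -> M) (c : 'rV[R]_n) : M :=
  \sum_i c 0 i *: p i.

Lemma row_comb_linear n (M : lmodType R) (p : 'I_n -> M) : linear (row_comb p).
Proof.
move=> a c d; rewrite scaler_sumr -big_split; apply: eq_bigr => i _ /=.
by rewrite !mxE scalerDl scalerA.
Qed.

HB.instance Definition _ n (M : lmodType R) (p : 'I_n -> M) :=
  GRing.isLinear.Build R 'rV[R]_n M *:%R (row_comb p) (row_comb_linear p).

Definition row_entry n (i : 'I_n) (c : 'rV[R]_n) : R^o := c 0 i.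

Lemma row_entry_linear n (i : 'I_n) : linear (row_entry i).
Proof. by move=> a c d; rewrite /row_entry !mxE. Qed.

HB.instance Definition _ n (i : 'I_n) :=
  GRing.isLinear.Build R 'rV[R]_n R^o *:%R (row_entry i) (row_entry_linear i).

(** This form of finitely generated projectivity makes lifts out of P and extensions into P
    explicit, coordinate by coordinate. *)
Definition fin_dual_basis (P : lmodType R) : Prop :=
  exists n (p : 'I_n -> P) (phi : 'I_n -> {linear P -> R^o}),
    forall x, x = \sum_i (phi i x : R) *: p i.

Lemma row_dual_basis n : fin_dual_basis 'rV[R]_n.
Proof.
exists n, (delta_mx 0), (@row_entry n) => x; exact: row_sum_delta.
Qed.

Lemma fin_dual_basis_lift (P M N : lmodType R) (g : {linear M -> N})
    (f : {linear P -> N}) :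
  fin_dual_basis P -> (forall y, exists x, g x = y) ->
  exists h : {linear P -> M}, forall x, g (h x) = f x.
Proof.
move=> [n [p [phi pE]]] /choice[s sE].
have [|h hE] := @linear_mapP R P M (fun x => \sum_i (phi i x : R) *: s (f (p i))).
  move=> a x y; rewrite scaler_sumr -big_split; apply: eq_bigr => i _ /=.
  by rewrite linearP scalerDl -scalerA.
exists h => x; rewrite hE linear_sum {2}[x]pE linear_sum.
by apply: eq_bigr => i _; rewrite !linearZ /= sE.
Qed.

Lemma fin_dual_basis_projective (P : lmodType R) :
  fin_dual_basis P <-> fin_gen P /\ projective_module P.
Proof.
split=> [P_db|[[n [p pE]] P_proj]].
  split=> [|M N g f]; last exact: fin_dual_basis_lift.
  case: P_db => n [p [phi pE]]; exists n, p => x.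
  by exists (fun i => phi i x); apply: pE.
have [|h hE] := P_proj _ _ (row_comb p) idfun.
  move=> y; have [c ->] := pE y; exists (\row_i c i).
  by apply: eq_bigr => i _; rewrite mxE.
exists n, p, (fun i => row_entry i \o h) => x.
by rewrite -{1}[x]/(idfun x) -hE.
Qed.

(** Surjectivity of Hom(f, R). When N is finitely generated projective, f is then a left
    approximation of M by such modules, by [ext_prop_extend]. *)
Definition ext_prop (M N : lmodType R) (f : {linear M -> N}) : Prop :=
  forall phi : {linear M -> R^o}, exists psi : {linear N -> R^o},
    forall x, psi (f x) = phi x.

Lemma ext_prop_extend (M N Q : lmodType R) (f : {linear M -> N})
    (h : {linear M -> Q}) :
  ext_prop f -> fin_dual_basis Q ->
  exists g : {linear N -> Q}, forall x, g (f x) = h x.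
Proof.
move=> f_ext [n [q [phi qE]]].
have /choice[psi psiE] i := f_ext (phi i \o h).
have [|g gE] := @linear_mapP R N Q (fun y => \sum_i (psi i y : R) *: q i).
  move=> a x y; rewrite scaler_sumr -big_split; apply: eq_bigr => i _ /=.
  by rewrite linearP scalerDl -scalerA.
exists g => x; rewrite gE [RHS]qE; apply: eq_bigr => i _.
by rewrite psiE.
Qed.

End DualBasis.

(** * Schanuel's lemma for stable summands *)

Section StableSummands.

Variable R : pzRingType.

Definition short_exact (K P M : lmodType R) (j : {linear K -> P})
    (e : {linear P -> M}) : Prop :=
  [/\ injective j, exact_at j e & forall y, exists x, e x = y].

Lemma exact0 (K P M : lmodType R) (j : {linear K -> P}) (e : {linear P -> M}) x :
  exact_at j e -> e (j x) = 0.
Proof. by move=> je; apply/je; exists x. Qed.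

(* M is a direct summand of N in the category of modules modulo maps that     *)
(* factor through finitely generated projectives.                             *)
Definition stable_summand (M N : lmodType R) : Prop :=
  exists (Q : lmodType R) (f : {linear M -> N}) (g : {linear N -> M})
         (u : {linear M -> Q}) (v : {linear Q -> M}),
    fin_dual_basis Q /\ forall x, x = g (f x) + v (u x).

Section Compare.

Variables (K P M K' P' M' : lmodType R).
Variables (j : {linear K -> P}) (e : {linear P -> M}).
Variables (j' : {linear K' -> P'}) (e' : {linear P' -> M'}).
Hypothesis ses : short_exact j e.
Hypothesis ses' : short_exact j' e'.
Hypothesis P_db : fin_dual_basis P.
Hypothesis P_db' : fin_dual_basis P'.

(** The maps f and g lift to F and G on the projectives, and v lifts to V. The last conclusion
    exhibits K as a stable summand of K' through P; the compatibility of a with F is kept in order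
    to transport [ext_prop]. *)
Lemma stable_summand_kernel : stable_summand M M' ->
  exists (F : {linear P -> P'}) (a : {linear K -> K'}) (b : {linear K' -> K})
         (s : {linear P -> K}),
    (forall x, j' (a x) = F (j x)) /\ forall x, x = b (a x) + s (j x).
Proof.
have [[j_inj je e_surj] [j_inj' je' e_surj']] := (ses, ses').
move=> [Q [f [g [u [v [Q_db fgE]]]]]].
have [F FE] := fin_dual_basis_lift (f \o e) P_db e_surj'.
have [G GE] := fin_dual_basis_lift (g \o e') P_db' e_surj.
have [V VE] := fin_dual_basis_lift v Q_db e_surj.
have [|a aE] := @linear_lift_inj R K' P' K j' (F \o j) j_inj'.
  by move=> x; apply/je'; rewrite FE /= (exact0 _ je) linear0.
have [|b bE] := @linear_lift_inj R K P K' j (G \o j') j_inj.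
  by move=> x; apply/je; rewrite GE /= (exact0 _ je') linear0.
(* Applying e gives (1 - g f - v u) e = 0, so this endomorphism of P lands in K; on K its last term
   vanishes and what remains is 1 - b a. *)
have [|s sE] := @linear_lift_inj R K P P j (idfun \- (G \o F) \- (V \o u \o e)) j_inj.
  move=> x; apply/je; rewrite /= !linearB GE /= FE VE /=.
  by rewrite {1}[e x]fgE addrAC addrK subrr.
exists F, a, b, s; split=> // x; apply: j_inj.
rewrite linearD bE /= aE sE /= (exact0 _ je) (linear0 u) (linear0 V) oppr0 addr0.
by rewrite addrC subrK.
Qed.

End Compare.

(** Dual to the kernel case: [ext_prop] replaces projectivity, and maps are extended along j and j'
    instead of lifted along e and e'. *)
Lemma stable_summand_cokernel (M P C M' P' C' : lmodType R)
    (j : {linear M -> P}) (e : {linear P -> C})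
    (j' : {linear M' -> P'}) (e' : {linear P' -> C'}) :
  short_exact j e -> short_exact j' e' ->
  fin_dual_basis P -> fin_dual_basis P' -> ext_prop j -> ext_prop j' ->
  stable_summand M M' -> stable_summand C C'.
Proof.
move=> [j_inj je e_surj] [j_inj' je' e_surj'] P_db P_db' j_ext j_ext'.
move=> [Q [f [g [u [v [Q_db fgE]]]]]].
have [F FE] := ext_prop_extend (j' \o f) j_ext P_db'.
have [G GE] := ext_prop_extend (j \o g) j_ext' P_db.
have [U UE] := ext_prop_extend u j_ext Q_db.
have [|a aE] := @linear_lift_surj R P C C' e (e' \o F) e_surj.
  by move=> _ /je[x <-] /=; rewrite FE (exact0 _ je').
have [|b bE] := @linear_lift_surj R P' C' C e' (e \o G) e_surj'.
  by move=> _ /je'[x <-] /=; rewrite GE (exact0 _ je).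
(* This endomorphism kills j(M) because 1 = g f + v u on M; hence 1 - b a on C factors through the
   projective P as e w. *)
have [|w wE] := @linear_lift_surj R P C P e
    (idfun \- (G \o F) \- (j \o v \o U)) e_surj.
  move=> _ /je[x <-] /=; rewrite FE GE UE /= {1}[x]fgE linearD.
  by rewrite addrAC addrK subrr.
exists P, a, b, w, e; split=> // y; have [x <-] := e_surj y.
rewrite wE aE /= bE /= !linearB /= (exact0 _ je) subr0.
by rewrite addrC subrK.
Qed.

End StableSummands.

(** * Syzygies of complete resolutions and their stable summands *)

Section CompleteSyzygies.

Variable R : pzRingType.

(** The position i is left free, so that moving one step along a resolution needs no reindexing. The
    converse half of dual exactness follows from the composites of successive differentials being
    zero. *)
Definition complete_syzygy (M : lmodType R) : Prop :=
  exists (P : int -> lmodType R) (d : forall i, {linear P i -> P (i + 1)}) i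
         (iota : {linear M -> P i}),
    [/\ forall i, fin_dual_basis (P i),
        forall i, exact_at (d i) (d (i + 1)),
        forall i (f : {linear P (i + 1) -> R^o}), (forall x, f (d i x) = 0) ->
          exists g : {linear P (i + 1 + 1) -> R^o},
            forall x, g (d (i + 1) x) = f x
      & injective iota /\ exact_at iota (d i)].

Lemma Gproj_complete_syzygy M : Gproj M -> complete_syzygy M.
Proof.
move=> [_ [P [d [P_proj dd d_ext [iota iotaP]]]]]; exists P, d, 1, iota.
split=> // [i|i f]; first exact/fin_dual_basis_projective.
by move/d_ext.
Qed.

(** Substituting i' + 1 for an index avoids a transport between P i and P (i - 1 + 1). *)
Lemma int_pred_exists (i : int) : exists i', i = i' + 1.
Proof. by exists (i - 1); rewrite subrK. Qed.

Section Splice.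

Variables (P : int -> lmodType R) (d : forall i, {linear P i -> P (i + 1)}).
Hypothesis dd : forall i, exact_at (d i) (d (i + 1)).
Hypothesis d_ext : forall i (f : {linear P (i + 1) -> R^o}),
  (forall x, f (d i x) = 0) ->
  exists g : {linear P (i + 1 + 1) -> R^o}, forall x, g (d (i + 1) x) = f x.

Lemma complete_syzygy_cover i (M : lmodType R) (iota : {linear M -> P (i + 1)}) :
  injective iota -> exact_at iota (d (i + 1)) ->
  exists2 e : {linear P i -> M}, (forall x, iota (e x) = d i x)
                               & forall y, exists x, e x = y.
Proof.
move=> iota_inj iota_ex.
have [|e eE] := @linear_lift_inj R M (P (i + 1)) (P i) iota (d i) iota_inj.
  by move=> x; apply/iota_ex; apply/dd; exists x.
exists e => // y.
have /dd[x xE] : d (i + 1) (iota y) = 0 by apply/iota_ex; exists y.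
by exists x; apply: iota_inj; rewrite eE.
Qed.

(** A functional on M, pulled back to the preceding projective that covers M, is a cocycle of the
    dual complex; that it is a coboundary says exactly that it extends. *)
Lemma complete_syzygy_ext_prop i (M : lmodType R) (iota : {linear M -> P i}) :
  injective iota -> exact_at iota (d i) -> ext_prop iota.
Proof.
have [i' i'E] := int_pred_exists i; have [i0 i0E] := int_pred_exists i'.
subst i' i => iota_inj iota_ex phi.
have [e eE e_surj] := complete_syzygy_cover iota_inj iota_ex.
have [|g gE] := d_ext (f := phi \o e).
  move=> x; rewrite /= -[RHS](linear0 phi); congr (phi _); apply: iota_inj.
  by rewrite eE linear0; apply/dd; exists x.
by exists g => y; have [x <-] := e_surj y; rewrite eE gE.
Qed.

End Splice.

Lemma complete_syzygy_left M : complete_syzygy M ->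
  exists (K P : lmodType R) (j : {linear K -> P}) (e : {linear P -> M}),
    [/\ short_exact j e, fin_dual_basis P, ext_prop j & complete_syzygy K].
Proof.
move=> [P [d [i [iota [P_db dd d_ext [iota_inj iota_ex]]]]]].
have [i' i'E] := int_pred_exists i; subst i.
have [e eE e_surj] := complete_syzygy_cover dd iota_inj iota_ex.
have [K [j [j_inj je]]] := kernel_exists e.
have jd : exact_at j (d i').
  move=> x; rewrite -eE -je; split=> [|->]; last by rewrite linear0.
  by rewrite -[X in _ = X -> _](linear0 iota) => /iota_inj.
exists K, (P i'), j, e; split=> //.
  exact: (complete_syzygy_ext_prop dd d_ext).
by exists P, d, i', j.
Qed.

Lemma complete_syzygy_right M : complete_syzygy M ->
  exists (P C : lmodType R) (j : {linear M -> P}) (e : {linear P -> C}),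
    [/\ short_exact j e, fin_dual_basis P, ext_prop j & complete_syzygy C].
Proof.
move=> [P [d [i [iota [P_db dd d_ext [iota_inj iota_ex]]]]]].
have [C [k [k_inj kd]]] := kernel_exists (d (i + 1)).
have [e eE e_surj] := complete_syzygy_cover dd k_inj kd.
exists (P i), C, iota, e; split=> //.
- split=> // x; rewrite -iota_ex -eE; split=> [->|]; first by rewrite linear0.
  by rewrite -[X in _ = X -> _](linear0 k) => /k_inj.
- exact: (complete_syzygy_ext_prop dd d_ext).
- by exists P, d, (i + 1), k.
Qed.

(** The cover or approximation of M need not be the one occurring in a complete resolution; passing
    to stable summands makes the class insensitive to this choice. *)
Definition stable_syzygy (M : lmodType R) : Prop :=
  exists2 Z, complete_syzygy Z & stable_summand M Z.

Lemma Gproj_stable_syzygy M : Gproj M -> stable_syzygy M.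
Proof.
move=> /Gproj_complete_syzygy M_syz; exists M => //.
exists 'rV[R]_0, idfun, idfun, \0, \0; split; first exact: row_dual_basis.
by move=> x; rewrite addr0.
Qed.

Section ShortExact.

Variables (K P M : lmodType R) (j : {linear K -> P}) (e : {linear P -> M}).
Hypotheses (ses : short_exact j e) (P_db : fin_dual_basis P).

Lemma stable_syzygy_kernel : stable_syzygy M -> stable_syzygy K.
Proof.
move=> [Z /complete_syzygy_left[K' [P' [j' [e' [ses' P_db' _ K_syz']]]]] MZ].
exists K' => //.
have [F [a [b [s [_ abE]]]]] := stable_summand_kernel ses ses' P_db P_db' MZ.
by exists P, a, b, j, s.
Qed.

(** On K one has phi = phi b a + phi s j. The second term visibly extends along j; for the first,
    phi b extends along j' and is pulled back by F. *)
Lemma stable_syzygy_ext_prop : stable_syzygy M -> ext_prop j.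
Proof.
move=> [Z /complete_syzygy_left[K' [P' [j' [e' [ses' P_db' j_ext' _]]]]] MZ] phi.
have [F [a [b [s [FE abE]]]]] := stable_summand_kernel ses ses' P_db P_db' MZ.
have [psi psiE] := j_ext' (phi \o b).
exists ((psi \o F) \+ (phi \o s)) => x /=.
by rewrite -FE psiE /= -linearD -abE.
Qed.

End ShortExact.

(** Both j' f and u factor through j, so j z = 0 forces f z = 0 and u z = 0, whence z = g (f z) + v
    (u z) = 0. *)
Lemma stable_syzygy_injective (M P : lmodType R) (j : {linear M -> P}) :
  stable_syzygy M -> ext_prop j -> injective j.
Proof.
move=> [Z /complete_syzygy_right[P' [C' [j' [e' [[j_inj' _ _] P_db' _ _]]]]] MZ].
case: MZ => Q [f [g [u [v [Q_db fgE]]]]] j_ext x y jxy.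
have [F FE] := ext_prop_extend (j' \o f) j_ext P_db'.
have [U UE] := ext_prop_extend u j_ext Q_db.
apply/eqP; rewrite -subr_eq0; apply/eqP; set z := x - y.
have jz : j z = 0 by rewrite linearB jxy subrr.
have fz : f z = 0.
  by apply: j_inj'; rewrite -[LHS]FE jz !linear0.
by rewrite [z]fgE fz -[u z]UE jz !linear0 addr0.
Qed.

Lemma stable_syzygy_cokernel (M P C : lmodType R) (j : {linear M -> P})
    (e : {linear P -> C}) :
  short_exact j e -> fin_dual_basis P -> ext_prop j ->
  stable_syzygy M -> stable_syzygy C.
Proof.
move=> ses P_db j_ext [Z Z_syz MZ].
have [P' [C' [j' [e' [ses' P_db' j_ext' C_syz']]]]] := complete_syzygy_right Z_syz.
by exists C' => //; apply: stable_summand_cokernel ses ses' _ _ _ _ MZ.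
Qed.

(** Finite generation of Hom(M, R) as a right module. Write phi = phi g f + phi v u; phi g extends
    to P' and phi v lives on Q, so dual bases of P' and Q supply the generators. *)
Lemma stable_syzygy_dual_gen (M : lmodType R) : stable_syzygy M ->
  exists n (u : 'I_n -> {linear M -> R^o}), forall phi : {linear M -> R^o},
    exists c : 'I_n -> R, forall x, phi x = \sum_i u i x * c i.
Proof.
move=> [Z /complete_syzygy_right[P' [C' [j' [e' [_ P_db' j_ext' _]]]]] MZ].
case: MZ => Q [f [g [r [v [[m [q [chi qE]]] fgE]]]]].
case: P_db' => n [p [psi pE]].
exists (n + m)%N, (fun i => match fintype.split i with
  | inl i => (psi i \o j' \o f : {linear M -> R^o})
  | inr i => (chi i \o r : {linear M -> R^o}) end) => phi.
have [h hE] := j_ext' (phi \o g).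
exists (fun i => match fintype.split i with
  | inl i => h (p i) | inr i => phi (v (q i)) end) => x.
rewrite big_split_ord /= {1}[x]fgE linearD; congr (_ + _).
  rewrite -[LHS]/((phi \o g) (f x)) -hE [j' _]pE linear_sum.
  by apply: eq_bigr => i _; rewrite (unsplitK (inl i)) linearZ.
rewrite [r x]qE !linear_sum.
by apply: eq_bigr => i _; rewrite (unsplitK (inr i)) !linearZ.
Qed.

End CompleteSyzygies.

(** * Splicing short exact sequences into a complete resolution *)

Section GprojOfClass.

Variables (R : pzRingType) (C : lmodType R -> Prop).

Hypothesis C_left : forall M, C M ->
  exists (K P : lmodType R) (j : {linear K -> P}) (e : {linear P -> M}),
    [/\ short_exact j e, fin_dual_basis P, ext_prop j & C K].
Hypothesis C_right : forall M, C M ->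
  exists (P N : lmodType R) (j : {linear M -> P}) (e : {linear P -> N}),
    [/\ short_exact j e, fin_dual_basis P, ext_prop j & C N].

(** The middle term and both maps form a single witness, so that one choice extracts them
    together. *)
Definition class_step (M N : lmodType R) : Prop :=
  exists t : {P : lmodType R & ({linear M -> P} * {linear P -> N})%type},
    [/\ short_exact (projT2 t).1 (projT2 t).2, fin_dual_basis (projT1 t)
      & ext_prop (projT2 t).1].

Lemma class_steps X : C X -> exists Y : int -> lmodType R,
  Y 1 = X /\ forall i, class_step (Y i) (Y (i + 1)).
Proof.
move=> CX; pose T := {M | C M}.
have [l lP] : {l : T -> T & forall M, class_step (sval (l M)) (sval M)}.
  apply: (@choice T T (fun M K => class_step (sval K) (sval M))) => M.
  case: M => M CM; have [K [P [j [e [ses P_db j_ext CK]]]]] := C_left CM.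
  by exists (exist _ K CK), (existT _ P (j, e)).
have [r rP] : {r : T -> T & forall M, class_step (sval M) (sval (r M))}.
  apply: (@choice T T (fun M N => class_step (sval M) (sval N))) => M.
  case: M => M CM; have [P [N [j [e [ses P_db j_ext CN]]]]] := C_right CM.
  by exists (exist _ N CN), (existT _ P (j, e)).
pose X0 : T := exist _ X CX.
(* [Negz n] stands for -(n + 1), hence the n + 1 steps to the left. *)
pose Y i := sval match i with Posz n => iter n r X0 | Negz n => iter n.+1 l X0 end.
have YP i : class_step (Y i) (Y (i + 1)).
  case: i => [n|[|n]]; [rewrite addrC -intS; exact: rP|exact: lP|].
  suff -> : Negz n.+1 + 1 = Negz n by exact: lP.
  by rewrite !NegzE [X in - X + _]intS opprD addrAC addNr add0r.
(* The shift places X at index 1, where [Gproj] takes the kernel. *)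
exists (fun i => Y (i - 1)); split=> // i.
by rewrite addrAC; apply: YP.
Qed.

(** The differential is the composite P i -> Y (i + 1) -> P (i + 1). A functional that kills its
    image descends to Y (i + 1 + 1), and [ext_prop] extends it to the next projective: this is dual
    exactness. *)
Lemma Gproj_of_class X : fin_gen X -> C X -> Gproj X.
Proof.
move=> X_fg /class_steps[Y [<- Y_step]] {X_fg}.
have Y1_fg : fin_gen (Y 1).
  have [[P [j e]] /= [[_ _ e_surj] /fin_dual_basis_projective[[n [p pE]] _] _]] :=
    Y_step 0.
  exists n, (e \o p) => y; have [x <-] := e_surj y.
  have [c ->] := pE x; exists c; rewrite linear_sum.
  by apply: eq_bigr => i _; rewrite linearZ.
pose t i := sval (cid (Y_step i)).
pose P i := projT1 (t i).
pose j i : {linear Y i -> P i} := (projT2 (t i)).1.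
pose e i : {linear P i -> Y (i + 1)} := (projT2 (t i)).2.
have [ses P_db j_ext] : [/\ forall i, short_exact (j i) (e i),
    forall i, fin_dual_basis (P i) & forall i, ext_prop (j i)].
  by split=> i; rewrite /j /e /P /t; case: cid => ? [].
have j_inj i : injective (j i) by case: (ses i).
have je i : exact_at (j i) (e i) by case: (ses i).
have e_surj i y : exists x, e i x = y by case: (ses i).
have jd i : exact_at (j i) (j (i + 1) \o e i).
  move=> x /=; rewrite -je; split=> [|->]; last by rewrite linear0.
  by rewrite -[X in _ = X -> _](linear0 (j (i + 1))) => /j_inj.
split=> //; exists P, (fun i => j (i + 1) \o e i); split=> [i|i y|i f|].
- exact/fin_dual_basis_projective.
- rewrite jd; split=> [[x <-]|[x <-]]; last by exists (e i x).
  by have [x' <-] := e_surj _ x; exists x'.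
- split=> [fd|[g gE] x]; last by rewrite -gE /= (exact0 _ (je _)) (linear0 (j _)) (linear0 g).
  have fj y : f (j (i + 1) y) = 0 by have [x <-] := e_surj _ y; apply: fd.
  have [|h hE] := @linear_lift_surj R _ _ _ (e (i + 1)) f (e_surj _).
    by move=> _ /je[y <-].
  have [g gE] := j_ext _ h.
  by exists g => x /=; rewrite gE hE.
- by exists (j 1); split.
Qed.

End GprojOfClass.

(** * Dimension counts by numbers of generators over k *)

Section Generators.

Definition gen_by (R : pzRingType) (n : nat) (M : lmodType R) : Prop :=
  exists g : 'I_n -> M, forall m, exists c : 'I_n -> R, m = \sum_i c i *: g i.

Lemma gen_by_surj (R : pzRingType) n (M N : lmodType R) (e : {linear M -> N}) :
  (forall y, exists x, e x = y) -> gen_by n M -> gen_by n N.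
Proof.
move=> e_surj [g gE]; exists (e \o g) => y; have [x <-] := e_surj y.
have [c ->] := gE x; exists c; rewrite linear_sum.
by apply: eq_bigr => i _; rewrite linearZ.
Qed.

Variables (k : fieldType) (W : lmodType k).

(** A subspace L of k^m of maximal dimension among those mapping into j(K) contains every vector
    mapping into j(K), so its basis yields generators of K. If j misses a point, L misses its
    preimages and is proper. *)
Lemma gen_by_subspace m (K : lmodType k) (j : {linear K -> W}) :
  gen_by m W -> injective j ->
  exists m', [/\ gen_by m' K, (m' <= m)%N
    & (exists x, forall y, j y <> x) -> (m' < m)%N].
Proof.
move=> [g gE] j_inj; pose V : vectType k := 'rV[k]_m; pose p : {linear V -> W} := row_comb g.
have p_surj x : exists v : V, p v = x.
  have [c ->] := gE x; exists (\row_i c i).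
  by apply: eq_bigr => i _; rewrite mxE.
pose inU (L : {vspace V}) := forall v, v \in L -> exists y, j y = p v.
pose Q d := `[< exists2 L, \dim L = d & inU L >].
have Q0 : exists d, Q d.
  exists 0%N; apply/asboolP; exists 0%VS; first exact: dimv0.
  by move=> v; rewrite memv0 => /eqP ->; exists 0; rewrite (linear0 j) (linear0 p).
have Qm d : Q d -> (d <= m)%N.
  move=> /asboolP[L <- _]; apply: leq_trans (dimvS (subvf L)) _.
  by rewrite dimvf /dim /= mul1n.
case: (ex_maxnP Q0 Qm) => d /asboolP[L dL LU] d_max.
have memL v : (exists y, j y = p v) -> v \in L.
  move=> [y yE]; have /asboolP/d_max : exists2 L', \dim L' = \dim (L + <[v]>)%VS & inU L'.
    exists (L + <[v]>)%VS => // _ /memv_addP[w /LU[z zE] [_ /vlineP[c ->] ->]].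
    by exists (z + c *: y); rewrite !(linearD, linearZ) /= yE zE.
  rewrite -dL => leLv.
  have /eqP -> : L == (L + <[v]>)%VS by rewrite eqEdim addvSl.
  by rewrite memvE addvSr.
have /choice[u uE] (i : 'I_(\dim L)) : exists y, j y = p (vbasis L)`_i.
  by apply/LU/vbasis_mem/mem_nth; rewrite size_tuple.
exists (\dim L); split=> [||[x xU]].
- exists u => y; have [v vE] := p_surj (j y).
  have /coord_vbasis vL : v \in L by apply: memL; exists y.
  exists (fun i => coord (vbasis L) i v); apply: j_inj.
  rewrite -vE {1}vL !linear_sum; apply: eq_bigr => i _.
  by rewrite !linearZ /= uE.
- by rewrite dL; apply: Qm; apply/asboolP; exists L.
- have [v vE] := p_surj x.
  rewrite (leq_trans (n := \dim {:V})) ?dimvf /dim /= ?mul1n //.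
  rewrite -[X in (_ < X)%N]mul1n -[X in (_ < X)%N]/(dim V) -dimvf.
  rewrite ltn_neqAle dimvS ?subvf // andbT.
  apply/eqP => eqd; have vL : v \in L.
    have /eqP -> : L == fullv by rewrite eqEdim subvf eqd leqnn.
    exact: memvf.
  by have [y yE] := LU v vL; apply: (xU y); rewrite yE.
Qed.

Lemma gen_by_quotient m (Q : lmodType k) (e : {linear W -> Q}) u :
  gen_by m W -> (forall y, exists x, e x = y) -> u != 0 -> e u = 0 ->
  exists2 m', gen_by m' Q & (m' < m)%N.
Proof.
move=> [g gE] e_surj u0 eu0; have [c cE] := gE u.
have [i0 ci0] : exists i, c i != 0.
  apply/existsP; apply: contraNT u0 => /existsPn c0.
  by rewrite cE big1 // => i _; have /negPn/eqP-> := c0 i; rewrite scale0r.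
case: m g gE c cE i0 ci0 => [|m] g gE c cE i0 ci0; first by case: i0 ci0.
exists m => //; exists (fun i => e (g (lift i0 i))) => y.
have [x <-] := e_surj y; have [d ->] := gE x.
(* Subtracting the multiple d i0 / c i0 of u, which e kills, eliminates the generator g i0. *)
exists (fun i => d (lift i0 i) - d i0 / c i0 * c (lift i0 i)).
have -> : e (\sum_i d i *: g i) = e (\sum_i d i *: g i - (d i0 / c i0) *: u).
  by rewrite linearB linearZ /= eu0 scaler0 subr0.
rewrite cE scaler_sumr -sumrB (bigD1_ord i0) //= scalerA -mulrA mulVf // mulr1.
rewrite subrr add0r linear_sum; apply: eq_bigr => i _.
by rewrite scalerA -scalerBl linearZ.
Qed.

(* The functional descends to the image of g; one generator of W is absorbed  *)
(* at a time by enlarging U to U x k.                                         *)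
Lemma functional_factor (U : lmodType k) (g : {linear U -> W})
    (phi : {linear U -> k^o}) :
  fin_gen W -> (forall x, g x = 0 -> phi x = 0) ->
  exists chi : {linear W -> k^o}, forall x, chi (g x) = phi x.
Proof.
move=> [m [w wE]].
have {wE} : forall x, exists u c, x = g u + \sum_i c i *: w i.
  by move=> x; have [c ->] := wE x; exists 0, c; rewrite linear0 add0r.
elim: m U g phi w => [|m IHm] U g phi w wE g_phi.
  apply: linear_lift_surj => // x; have [u [c ->]] := wE x.
  by exists u; rewrite big_ord0 addr0.
have [a aE] : exists a : k^o, forall u c, g u + c *: w ord0 = 0 -> phi u + c * a = 0.
  have [[u0 u0E]|w_im] := pselect (exists u0, g u0 = w ord0).
    exists (phi u0) => u c; rewrite -u0E -linearZ -linearD => /g_phi.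
    by rewrite linearD linearZ.
  exists 0 => u c; have [->|c0 /eqP] := eqVneq c 0.
    by rewrite scale0r addr0 mulr0 addr0; apply: g_phi.
  rewrite addr_eq0 => /eqP guE; case: w_im; exists (- c^-1 *: u).
  by rewrite linearZ /= guE scalerN scaleNr opprK scalerA mulVf // scale1r.
pose U' : lmodType k := (U * k^o)%type.
have [|g' gE'] := @linear_mapP k U' W (fun x => g x.1 + (x.2 : k) *: w ord0).
  by move=> b x y /=; rewrite linearP scalerDr scalerDl scalerA addrACA.
have [|phi' phiE'] := @linear_mapP k U' k^o (fun x => phi x.1 + x.2 * a).
  move=> b x y /=; rewrite linearP scalerDr mulrDl addrACA.
  by congr (_ + (_ + _)); rewrite /GRing.scale /= mulrA.
have [||chi chiE] := IHm U' g' phi' (fun i => w (lift ord0 i)).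
- move=> x; have [u [c ->]] := wE x; exists (u, c ord0), (fun i => c (lift ord0 i)).
  by rewrite big_ord_recl gE' addrA.
- by move=> x; rewrite gE' phiE'; apply: aE.
exists chi => x; have := chiE (x, 0).
by rewrite gE' phiE' /= scale0r mul0r !addr0.
Qed.

End Generators.

(** * Restriction of scalars *)

Section RestrictionOfScalars.

Variables (R S : pzRingType) (f : {rmorphism R -> S}).

Section Def.

Variable M : lmodType S.

Definition restr (_ : {rmorphism R -> S}) : Type := M.

HB.instance Definition _ := GRing.Zmodule.on (restr f).

Definition restr_scale (a : R) (x : restr f) : restr f := f a *: (x : M).

Fact restr_scaleA a b x : restr_scale a (restr_scale b x) = restr_scale (a * b) x.
Proof. by rewrite /restr_scale rmorphM scalerA. Qed.
Fact restr_scale1 : left_id 1 restr_scale.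
Proof. by move=> x; rewrite /restr_scale rmorph1 scale1r. Qed.
Fact restr_scaleDr : right_distributive restr_scale +%R.
Proof. by move=> a x y; apply: scalerDr. Qed.
Fact restr_scaleDl x : {morph restr_scale^~ x : a b / a + b}.
Proof. by move=> a b; rewrite /restr_scale rmorphD scalerDl. Qed.

HB.instance Definition _ := GRing.Zmodule_isLmodule.Build R (restr f)
  restr_scaleA restr_scale1 restr_scaleDr restr_scaleDl.

Lemma restrZ a (x : restr f) : a *: x = f a *: (x : M).
Proof. by []. Qed.

End Def.

Lemma restr_map_exists (M N : lmodType S) (h : {linear M -> N}) :
  exists h' : {linear restr M f -> restr N f}, forall x, h' x = h x.
Proof. by apply: linear_mapP => a x y; rewrite !restrZ linearP. Qed.

Lemma restr_fin_gen (M : lmodType S) :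
  fin_gen (restr S^o f) -> fin_gen M -> fin_gen (restr M f).
Proof.
move=> [m [s sE]] [n [g gE]].
have /choice[d dE] x : exists d : 'I_m -> R, x = \sum_i f (d i) * (s i : S).
  exact: sE.
pose T : finType := ('I_n * 'I_m)%type.
exists #|T|, (fun t => (s (enum_val t).2 : S) *: g (enum_val t).1) => x.
have [c ->] := gE x.
exists (fun t => d (c (enum_val t).1) (enum_val t).2).
pose F (t : T) := f (d (c t.1) t.2) *: ((s t.2 : S) *: g t.1).
transitivity (\sum_t F t); last exact: (big_enum_val (A := T) F).
rewrite -(pair_bigA _ (fun i j => F (i, j))) /F /=.
apply: eq_bigr => i _; rewrite {1}[c i]dE scaler_suml.
by apply: eq_bigr => j _; rewrite scalerA.
Qed.

End RestrictionOfScalars.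

Arguments restr {R S} M f.

(** * The two factors of A ⊗ B, and V ⊗_B X as an A-module *)

Section TensorFactors.

Variables (k : fieldType) (A B : falgType k).

Definition tensl (a : A) : A ⊗ B := ta_pure a 1.
Definition tensr (b : B) : A ⊗ B := ta_pure 1 b.

Lemma tensl_is_zmod_morphism : zmod_morphism tensl.
Proof.
move=> a b; apply/eqP; rewrite eq_sym subr_eq; apply/eqP.
by rewrite -pureDl subrK.
Qed.
Lemma tensl_is_monoid_morphism : monoid_morphism tensl.
Proof. by split=> // a b; rewrite [RHS]ta_mul_pure mulr1. Qed.

HB.instance Definition _ :=
  GRing.isZmodMorphism.Build A (A ⊗ B) tensl tensl_is_zmod_morphism.
HB.instance Definition _ :=
  GRing.isMonoidMorphism.Build A (A ⊗ B) tensl tensl_is_monoid_morphism.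

Lemma tensr_is_zmod_morphism : zmod_morphism tensr.
Proof.
move=> a b; apply/eqP; rewrite eq_sym subr_eq; apply/eqP.
by rewrite -pureDr subrK.
Qed.
Lemma tensr_is_monoid_morphism : monoid_morphism tensr.
Proof. by split=> // a b; rewrite [RHS]ta_mul_pure mulr1. Qed.

HB.instance Definition _ :=
  GRing.isZmodMorphism.Build B (A ⊗ B) tensr tensr_is_zmod_morphism.
HB.instance Definition _ :=
  GRing.isMonoidMorphism.Build B (A ⊗ B) tensr tensr_is_monoid_morphism.

Lemma tenslr a b : tensl a * tensr b = ta_pure a b.
Proof. by rewrite [LHS]ta_mul_pure mulr1 mul1r. Qed.

Lemma tensrl a b : tensr b * tensl a = ta_pure a b.
Proof. by rewrite [LHS]ta_mul_pure mulr1 mul1r. Qed.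

Lemma tenslr_comm a b : tensr b * tensl a = tensl a * tensr b.
Proof. by rewrite tenslr tensrl. Qed.

Lemma tenslr_scalar (c : k) : tensl c%:A = tensr c%:A.
Proof. exact: ta_pureZ. Qed.

Lemma tensalg_ind (P : A ⊗ B -> Prop) :
  (forall x y, P x -> P y -> P (x + y)) ->
  (forall a b, P (tensl a * tensr b)) -> forall x, P x.
Proof.
move=> PD Pp; elim/tens_ind=> [||a b].
- by have := Pp 0 0; rewrite rmorph0 mul0r.
- exact: PD.
- by rewrite -/(ta_pure a b) -tenslr; apply: Pp.
Qed.

End TensorFactors.

Arguments tensl {k A B} a.
Arguments tensr {k A B} b.

Section TensorProduct.

Variables (k : fieldType) (A B : falgType k) (V : lmodType B^c).

Section Generators.

Variable X : lmodType (A ⊗ B).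

(* v (x) x in V (x)_B X, which is (A (x)_k V) (x)_(A ⊗ B) X as an A-module.   *)
Definition tp (v : V) (x : X) : AtensV_tens V X := AVX_pure (AV_pure (1 : A) v) x.

Lemma tpDl v w x : tp (v + w) x = tp v x + tp w x.
Proof. by rewrite /tp /AV_pure pureDr; apply: pureDl. Qed.

Lemma tpDr v x y : tp v (x + y) = tp v x + tp v y.
Proof. exact: pureDr. Qed.

Lemma tp_bal (b : B) v x : tp ((b : B^c) *: v) x = tp v (tensr b *: x).
Proof.
rewrite /tp /AVX_pure -pure_bal; congr pure.
by rewrite [RHS]AV_act_pure mulr1.
Qed.

(** Since a ⊗ v = (1 ⊗ v)(a ⊗ 1), the factor a can be moved onto x, so the elements [tp v x]
    generate additively. *)
Lemma AVX_pureE a v x :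
  AVX_pure (AV_pure a v) x = tp v (tensl a *: x) :> AtensV_tens V X.
Proof.
rewrite /tp /AVX_pure -pure_bal; congr pure.
by rewrite [RHS]AV_act_pure mul1r scale1r.
Qed.

Lemma tpZ (a : A) v x : a *: tp v x = tp v (tensl a *: x).
Proof. by rewrite [LHS]AVX_scale_pure AV_lmul_pure mulr1 AVX_pureE. Qed.

Lemma tp_ind (P : AtensV_tens V X -> Prop) :
  (forall s t, P s -> P t -> P (s + t)) -> (forall v x, P (tp v x)) ->
  forall t, P t.
Proof.
move=> PD Pp; have P0 : P 0.
  have -> : 0 = tp 0 0 by apply: (addrI (tp 0 0)); rewrite -tpDl !addr0.
  exact: Pp.
elim/tens_ind=> [||s x]; [exact: P0|exact: PD|].
elim/tens_ind: s => [|s t Ps Pt|a v].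
- have -> : pure 0 x = 0 :> AtensV_tens V X.
    by apply: (addrI (pure 0 x)); rewrite -pureDl !addr0.
  exact: P0.
- by rewrite pureDl; apply: PD.
- by rewrite -/(AVX_pure _ x) -/(AV_pure a v) AVX_pureE.
Qed.

Section Lift.

Variables (G : zmodType) (h : V -> X -> G).
Hypothesis hDl : forall v w x, h (v + w) x = h v x + h w x.
Hypothesis hDr : forall v x y, h v (x + y) = h v x + h v y.
Hypothesis h_bal : forall (b : B) v x, h ((b : B^c) *: v) x = h v (tensr b *: x).

Let hA x (a : A) v := h v (tensl a *: x).

Let hA_bal x : balanced (fun (a : A) (c : k) => c *: a)
  (fun (c : k) (v : V) => (c%:A : B^c) *: v) (hA x).
Proof.
split=> [a a' v|a v w|a c v]; rewrite /hA.
- by rewrite rmorphD scalerDl hDr.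
- exact: hDl.
- rewrite h_bal scalerA -tenslr_scalar -rmorphM.
  by congr (h v (tensl _ *: x)); rewrite -scalerAl mul1r.
Qed.

(** The universal property of V ⊗_B X. The target is only an abelian group, so that it also serves
    B-linear maps that do not commute with A, and functionals with values in k. *)
Lemma tp_lift_exists : exists H : AtensV_tens V X -> G,
  (forall s t, H (s + t) = H s + H t) /\ forall v x, H (tp v x) = h v x.
Proof.
pose f (t : AtensV A V) x := tens_lift (hA x) t.
have fP : balanced (fun (t : AtensV A V) (r : A ⊗ B) => (r : (A ⊗ B)^c) *: t)
    (fun (r : A ⊗ B) (x : X) => r *: x) f.
  split=> [t u x|t x y|t r x].
  - exact: (tens_liftD (hA_bal x)).
  - by apply: tens_lift_addf => a v; rewrite /hA scalerDr hDr.
  elim/tens_ind: t => [|t u IHt IHu|a v].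
  - by rewrite scaler0 /f !(tens_lift0 (hA_bal _)).
  - by rewrite scalerDr /f !(tens_liftD (hA_bal _)) -!/(f _ _) IHt IHu.
  elim/tensalg_ind: r => [r s IHr IHs|a' b].
    rewrite !scalerDl [LHS](tens_liftD (hA_bal x)) -!/(f _ _) IHr IHs.
    by apply/esym/tens_lift_addf => a'' w; rewrite /hA scalerDr hDr.
  rewrite tenslr [_ *: _](AV_act_pure a' b a v).
  rewrite /f [LHS](tens_lift_pure (hA_bal _)) [RHS](tens_lift_pure (hA_bal _)).
  by rewrite /hA h_bal !scalerA -tenslr mulrA -rmorphM tenslr_comm.
exists (tens_lift f); split=> [s t|v x]; first exact: (tens_liftD fP).
rewrite [LHS](tens_lift_pure fP) [LHS](tens_lift_pure (hA_bal _)) /hA.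
by rewrite rmorph1 scale1r.
Qed.

End Lift.

Lemma tp_lift_linear (G : lmodType A) (h : V -> X -> G) :
  (forall v w x, h (v + w) x = h v x + h w x) ->
  (forall v x y, h v (x + y) = h v x + h v y) ->
  (forall (b : B) v x, h ((b : B^c) *: v) x = h v (tensr b *: x)) ->
  (forall (a : A) v x, h v (tensl a *: x) = a *: h v x) ->
  exists H : {linear AtensV_tens V X -> G}, forall v x, H (tp v x) = h v x.
Proof.
move=> hDl hDr h_bal hZ; have [H [HD HE]] := tp_lift_exists hDl hDr h_bal.
have HZ a t : H (a *: t) = a *: H t.
  elim/tp_ind: t => [s t IHs IHt|v x]; first by rewrite scalerDr !HD IHs IHt scalerDr.
  by rewrite tpZ !HE hZ.
have [|H' H'E] := @linear_mapP A (AtensV_tens V X) G H.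
  by move=> a s t; rewrite HD HZ.
by exists H' => v x; rewrite H'E.
Qed.

End Generators.

End TensorProduct.

(** * Retracts, split sequences and vector spaces *)

Section Retracts.

Variable R : pzRingType.

Lemma fin_dual_basis_retract (M P : lmodType R) (i : {linear M -> P})
    (r : {linear P -> M}) :
  (forall x, r (i x) = x) -> fin_dual_basis P -> fin_dual_basis M.
Proof.
move=> riK [n [p [phi pE]]]; exists n, (r \o p), (fun l => phi l \o i) => x.
rewrite -[LHS]riK [i x in LHS]pE linear_sum.
by apply: eq_bigr => l _; rewrite linearZ.
Qed.

Lemma fin_dual_basis_fintype (I : finType) (P : lmodType R) (p : I -> P)
    (phi : I -> {linear P -> R^o}) :
  (forall x, x = \sum_i (phi i x : R) *: p i) -> fin_dual_basis P.
Proof.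
move=> pE; exists #|I|, (p \o enum_val), (phi \o enum_val) => x.
rewrite {1}[x]pE; exact: (big_enum_val (A := I) (fun i => (phi i x : R) *: p i)).
Qed.

Lemma short_exact_section (K P M : lmodType R) (j : {linear K -> P})
    (e : {linear P -> M}) (s : {linear M -> P}) :
  short_exact j e -> (forall x, e (s x) = x) ->
  exists r : {linear P -> K},
    (forall x, r (j x) = x) /\ forall y, y = j (r y) + s (e y).
Proof.
move=> [j_inj je e_surj] esK.
have [|r rE] := @linear_lift_inj R K P P j (idfun \- (s \o e)) j_inj.
  by move=> y; apply/je; rewrite /= linearB esK subrr.
exists r; split=> [x|y]; last by rewrite rE /= subrK.
by apply: j_inj; rewrite rE /= (exact0 _ je) (linear0 s) oppr0 addr0.
Qed.

Lemma short_exact_retraction (K P M : lmodType R) (j : {linear K -> P})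
    (e : {linear P -> M}) (r : {linear P -> K}) :
  short_exact j e -> (forall x, r (j x) = x) ->
  exists s : {linear M -> P},
    (forall x, e (s x) = x) /\ forall y, y = j (r y) + s (e y).
Proof.
move=> [j_inj je e_surj] rjK.
have [|s sE] := @linear_lift_surj R P M P e (idfun \- (j \o r)) e_surj.
  by move=> _ /je[x <-]; rewrite /= rjK subrr.
exists s; split=> [x|y]; last by rewrite sE /= addrC subrK.
have [y <-] := e_surj x; rewrite sE linearB /= (exact0 _ je).
by rewrite oppr0 addr0.
Qed.

End Retracts.

(** A generating family of least size is a basis: a nontrivial relation would allow a smaller one by
    [gen_by_quotient]. *)
Lemma field_fin_dual_basis (k : fieldType) (W : lmodType k) :
  fin_gen W -> fin_dual_basis W.
Proof.
move=> [m0 gen0]; have ex_gen : exists m, `[< gen_by m W >].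
  by exists m0; apply/asboolP.
case: (ex_minnP ex_gen) => m /asboolP[g gE] m_min.
have row_gen : gen_by m 'rV[k]_m.
  exists (delta_mx 0) => v; exists (fun i => v 0 i); exact: row_sum_delta.
have g_surj y : exists x, row_comb g x = y.
  have [c ->] := gE y; exists (\row_i c i).
  by apply: eq_bigr => i _; rewrite mxE.
have g_inj : injective (row_comb g).
  move=> v w vw; apply/eqP; rewrite -subr_eq0; apply: contraT => vw0.
  have [|m' W_gen m'm] := gen_by_quotient row_gen g_surj vw0.
    by rewrite linearB /= vw subrr.
  by have := m_min m'; rewrite leqNgt m'm => /(_ (asboolT W_gen)).
have [|s sE] := @linear_lift_inj k _ W W (row_comb g) idfun g_inj.
  by move=> y; apply: g_surj.
exact: fin_dual_basis_retract sE (row_dual_basis k m).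
Qed.

Lemma falg_fin_gen (k : fieldType) (C : falgType k) :
  fin_gen (restr (C^o : lmodType C) (in_alg C)).
Proof.
exists (\dim {:C}), (fun i => (vbasis {:C})`_i) => x.
exists (fun i => coord (vbasis {:C}) i x).
rewrite {1}[x](coord_vbasis (memvf x)); apply: eq_bigr => i _.
by rewrite [RHS]mulr_algl.
Qed.

Lemma falg_fin_gen_restr (k : fieldType) (C : falgType k) (M : lmodType C) :
  fin_gen M -> fin_gen (restr M (in_alg C)).
Proof. exact/restr_fin_gen/falg_fin_gen. Qed.

(** * Functoriality of V ⊗_B X, and exactness on B-split sequences *)

Section TensorFunctor.

Variables (k : fieldType) (A B : falgType k) (V : lmodType B^c).

Definition tp_map (X Y : lmodType (A ⊗ B)) (h : {linear X -> Y}) :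
  AtensV_tens V X -> AtensV_tens V Y := tensmod_map (AtensV A V) h.

Section Map.

Variables (X Y : lmodType (A ⊗ B)) (h : {linear X -> Y}).

Let tp_map_bal : balanced
  (fun (t : AtensV A V) (r : A ⊗ B) => (r : (A ⊗ B)^c) *: t)
  (fun (r : A ⊗ B) (x : X) => r *: x)
  (fun t x => AVX_pure t (h x) : AtensV_tens V Y).
Proof.
split=> [t u x|t x y|t r x].
- exact: pureDl.
- by rewrite linearD; apply: pureDr.
- by rewrite linearZ; apply: pure_bal.
Qed.

Lemma tp_mapE v x : tp_map h (tp v x) = tp v (h x).
Proof. exact: (tens_lift_pure tp_map_bal). Qed.

Let tp_mapD s t : tp_map h (s + t) = tp_map h s + tp_map h t.
Proof. exact: (tens_liftD tp_map_bal). Qed.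

Lemma tp_map_linear : linear (tp_map h).
Proof.
move=> a s t; rewrite tp_mapD; congr (_ + _).
elim/tp_ind: s => [s s' IHs IHs'|v x]; last by rewrite tpZ !tp_mapE linearZ tpZ.
by rewrite scalerDr !tp_mapD IHs IHs' -scalerDr.
Qed.

HB.instance Definition _ := GRing.isLinear.Build A
  (AtensV_tens V X) (AtensV_tens V Y) *:%R (tp_map h) tp_map_linear.

End Map.

Lemma tp_map_tensr (X Y : lmodType (A ⊗ B))
    (h : {linear restr X tensr -> restr Y tensr}) :
  exists H : AtensV_tens V X -> AtensV_tens V Y,
    (forall s t, H (s + t) = H s + H t) /\ forall v x, H (tp v x) = tp v (h x).
Proof.
apply: (tp_lift_exists (h := fun v x => tp v (h x : Y))) => [v w x|v x y|b v x].
- exact: tpDl.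
- by rewrite (linearD h) tpDr.
- by rewrite tp_bal -[tensr b *: x](restrZ _ (x : restr X tensr)) linearZ.
Qed.

Lemma tp_map_surj (P M : lmodType (A ⊗ B)) (e : {linear P -> M}) :
  (forall y, exists x, e x = y) -> forall y, exists x, tp_map e x = y.
Proof.
move=> e_surj; elim/tp_ind=> [s t [s' <-] [t' <-]|v x].
  by exists (s' + t'); rewrite linearD.
by have [y <-] := e_surj x; exists (tp v y); rewrite tp_mapE.
Qed.

(** The B-linear splittings r and s induce additive maps on the tensor products, which is enough to
    split the image sequence and so to prove it exact. *)
Lemma tp_map_short_exact (K P M : lmodType (A ⊗ B)) (j : {linear K -> P})
    (e : {linear P -> M}) (r : {linear restr P tensr -> restr K tensr})
    (s : {linear restr M tensr -> restr P tensr}) :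
  short_exact j e -> (forall x, r (j x) = x) ->
  (forall y, y = j (r y) + s (e y)) -> short_exact (tp_map j) (tp_map e).
Proof.
move=> [_ je e_surj] rjK jrseE.
have [Tr [TrD TrE]] := tp_map_tensr r; have [Ts [TsD TsE]] := tp_map_tensr s.
have TrjK t : Tr (tp_map j t) = t.
  by elim/tp_ind: t => [t u {2}<- {2}<-|v x]; rewrite ?linearD ?TrD // tp_mapE TrE rjK.
have TE t : t = tp_map j (Tr t) + Ts (tp_map e t).
  elim/tp_ind: t => [t u|v x].
    by rewrite TrD (linearD (tp_map e)) (linearD (tp_map j)) TsD addrACA => <- <-.
  by rewrite TrE !tp_mapE TsE -tpDr -jrseE.
have Ts0 : Ts 0 = 0 by apply: (addrI (Ts 0)); rewrite -TsD !addr0.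
split; last exact: tp_map_surj; first exact: can_inj TrjK.
move=> t; split=> [et|[u <-]]; last first.
  elim/tp_ind: u => [u u' IHu IHu'|v x]; first by rewrite !linearD IHu IHu' addr0.
  rewrite /= !tp_mapE (exact0 _ je); apply: (addrI (tp v 0)).
  by rewrite -tpDr !addr0.
by exists (Tr t); rewrite [RHS]TE et Ts0 addr0.
Qed.

End TensorFunctor.

(** * Contraction of A ⊗ B against dual modules *)

Section Contraction.

Variables (k : fieldType) (A B : falgType k) (N : lmodType B).

(* a (x) b |-> beta (b s) a *)
Definition contract (beta : dualmod N) (s : N) (x : A ⊗ B) : A :=
  tens_lift (fun a b => beta (b *: s) *: a) x.

Lemma dual_scalar (beta : dualmod N) (c : k) (b : B) (s : N) :
  beta ((c *: b) *: s) = c * beta (b *: s).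
Proof. by rewrite -dualZ scalerA mulr_algl. Qed.

Let contract_bal (beta : dualmod N) (s : N) :
  balanced (fun (a : A) (c : k) => c *: a) (fun (c : k) (b : B) => c *: b)
    (fun a b => beta (b *: s) *: a).
Proof.
split=> [a a' b|a b b'|a c b].
- exact: scalerDr.
- by rewrite scalerDl dualD scalerDl.
- by rewrite dual_scalar scalerA mulrC.
Qed.

Lemma contract_pure beta s a b :
  contract beta s (tensl a * tensr b) = beta (b *: s) *: a.
Proof. by rewrite tenslr; apply: (tens_lift_pure (contract_bal _ _)). Qed.

Lemma contractD beta s x y :
  contract beta s (x + y) = contract beta s x + contract beta s y.
Proof. exact: (tens_liftD (contract_bal _ _)). Qed.

Lemma contract_sum (I : finType) beta s (F : I -> A ⊗ B) :
  contract beta s (\sum_i F i) = \sum_i contract beta s (F i).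
Proof.
apply: (big_morph (contract beta s)); first exact: contractD.
by apply: (addrI (contract beta s 0)); rewrite -contractD !addr0.
Qed.

Lemma contractDl beta gamma s x :
  contract (beta + gamma) s x = contract beta s x + contract gamma s x.
Proof. by apply: tens_lift_addf => a b; rewrite -scalerDl. Qed.

Lemma contract_tensl beta s a x :
  contract beta s (tensl a * x) = a * contract beta s x.
Proof.
elim/tensalg_ind: x => [x y IHx IHy|a' b]; first by rewrite mulrDr !contractD IHx IHy mulrDr.
by rewrite mulrA -rmorphM !contract_pure scalerAr.
Qed.

Lemma contract_mul_tensl beta s a x :
  contract beta s (x * tensl a) = contract beta s x * a.
Proof.
elim/tensalg_ind: x => [x y IHx IHy|a' b]; first by rewrite mulrDl !contractD IHx IHy mulrDl.
by rewrite -mulrA tenslr_comm mulrA -rmorphM !contract_pure scalerAl.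
Qed.

Lemma contract_tensr beta s (b : B) x :
  contract ((b : B^c) *: beta) s x = contract beta s (tensr b * x).
Proof.
elim/tensalg_ind: x => [x y IHx IHy|a b']; first by rewrite mulrDr !contractD IHx IHy.
by rewrite mulrA tenslr_comm -mulrA -rmorphM !contract_pure -scalerA.
Qed.

End Contraction.

(** * Dual bases over k, and D(N) ⊗_B X for N finitely generated *)

Section DualModule.

Variables (k : fieldType) (B : falgType k) (N : lmodType B).

Definition dual_pair m (s : 'I_m -> N) (sigma : 'I_m -> dualmod N) : Prop :=
  forall x, x = \sum_i (sigma i x)%:A *: s i.

Lemma dual_pair_exists : fin_gen N ->
  exists m (s : 'I_m -> N) (sigma : 'I_m -> dualmod N), dual_pair s sigma.
Proof.
move=> /falg_fin_gen_restr/field_fin_dual_basis[m [s [phi sE]]].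
have phiP i : `[< klinear (fun x : N => phi i x : k) >].
  apply/asboolP; split=> [x y|c x]; first exact: linearD.
  by rewrite -[c%:A *: x](restrZ (f := in_alg B) c x) linearZ.
by exists m, s, (fun i => Dualmod (phiP i)) => x; apply: sE.
Qed.

Variables (m : nat) (s : 'I_m -> N) (sigma : 'I_m -> dualmod N).
Hypothesis s_dual : dual_pair s sigma.

Lemma dual0 (beta : dualmod N) : beta 0 = 0.
Proof. by apply: (addrI (beta 0)); rewrite -dualD !addr0. Qed.

Lemma dual_sum (beta : dualmod N) (F : 'I_m -> N) :
  beta (\sum_i F i) = \sum_i beta (F i).
Proof. exact: (big_morph _ (dualD beta) (dual0 beta)). Qed.

Lemma dual_separates (x y : N) : (forall beta : dualmod N, beta x = beta y) -> x = y.
Proof.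
by move=> xy; rewrite [x]s_dual [y]s_dual; apply: eq_bigr => i _; rewrite xy.
Qed.

Lemma dualmod_sumE (F : 'I_m -> dualmod N) x : (\sum_i F i) x = \sum_i F i x.
Proof. by elim/big_rec2: _ => // i c f _ <-. Qed.

Lemma dualmod_scalarE (c : k) (beta : dualmod N) x :
  ((c%:A : B^c) *: beta) x = c * beta x.
Proof. exact: dualZ. Qed.

Lemma dual_expand (beta : dualmod N) :
  beta = \sum_i ((beta (s i))%:A : B^c) *: sigma i.
Proof.
apply: dual_eqP => x; rewrite dualmod_sumE [x in LHS]s_dual dual_sum.
by apply: eq_bigr => i _; rewrite dualmod_scalarE dualZ mulrC.
Qed.

End DualModule.

Section TensorDual.

Variables (k : fieldType) (A B : falgType k) (N : lmodType B).
Variables (m : nat) (s : 'I_m -> N) (sigma : 'I_m -> dualmod N).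
Hypothesis s_dual : dual_pair s sigma.

Lemma tp_sumr (I : finType) (V : lmodType B^c) (X : lmodType (A ⊗ B)) (v : V) (F : I -> X) :
  tp v (\sum_i F i) = \sum_i tp v (F i).
Proof.
apply: (big_morph (tp v)); first exact: tpDr.
by apply: (addrI (tp v 0)); rewrite -tpDr !addr0.
Qed.

Lemma tp_suml (I : finType) (V : lmodType B^c) (X : lmodType (A ⊗ B)) (F : I -> V) (x : X) :
  tp (\sum_i F i) x = \sum_i tp (F i) x.
Proof.
apply: (big_morph (fun v => tp v x)) => [v w|]; first exact: tpDl.
by apply: (addrI (tp 0 x)); rewrite -tpDl !addr0.
Qed.

Lemma tp_scalar (V : lmodType B^c) (X : lmodType (A ⊗ B)) (c : k) (v : V) (x : X) :
  tp ((c%:A : B^c) *: v) x = c%:A *: tp v x.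
Proof. by rewrite tp_bal tpZ tenslr_scalar. Qed.

Lemma tp_expand (X : lmodType (A ⊗ B)) (beta : dualmod N) (x : X) :
  tp beta x = \sum_i (beta (s i))%:A *: tp (sigma i) x.
Proof.
rewrite {1}(dual_expand s_dual beta) tp_suml.
by apply: eq_bigr => i _; rewrite tp_scalar.
Qed.

(** D(N) ⊗_B (A ⊗ B)^n is A^n ⊗_k D(N): it is generated over A by the sigma_i ⊗ e_j, and the
    coordinates are contractions against the s_i. *)
Lemma tens_free_dual_basis n :
  fin_dual_basis (AtensV_tens (dualmod N) 'rV[A ⊗ B]_n).
Proof.
have phi_exists (t : 'I_m * 'I_n) :
    exists phi : {linear AtensV_tens (dualmod N) 'rV[A ⊗ B]_n -> A^o},
    forall beta v, phi (tp beta v) = contract beta (s t.1) (v 0 t.2).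
  apply: tp_lift_linear => [*|*|b v x|a v x].
  - exact: contractDl.
  - by rewrite mxE contractD.
  - by rewrite contract_tensr mxE.
  - by rewrite mxE contract_tensl.
have /choice[phi phiE] := phi_exists.
apply: (@fin_dual_basis_fintype _ _ _
  (fun t => tp (sigma t.1) (delta_mx 0 t.2)) phi) => t.
elim/tp_ind: t => [t u {1}-> {1}->|beta v].
  by rewrite -big_split; apply: eq_bigr => i _; rewrite linearD scalerDl.
under eq_bigr do rewrite phiE.
rewrite {1}[v]row_sum_delta tp_sumr.
rewrite -(pair_bigA _ (fun i j => contract beta (s i) (v 0 j) *: tp (sigma i) (delta_mx 0 j))) /=.
rewrite exchange_big; apply: eq_bigr => j _ /=.
elim/tensalg_ind: (v 0 j) => [x y IHx IHy|a b].
  rewrite scalerDl tpDr IHx IHy -big_split.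
  by apply: eq_bigr => i _; rewrite contractD scalerDl.
rewrite -scalerA -tpZ -tp_bal tp_expand scaler_sumr.
apply: eq_bigr => i _; rewrite contract_pure scalerA; congr (_ *: _).
by rewrite -scalerAr mulr1.
Qed.

End TensorDual.

Section FreeOverFactor.

Variables (k : fieldType) (A B : falgType k).

(** A k-basis of A makes A ⊗ B a direct sum of copies of B; h i is the coordinate along the i-th
    copy. *)
Lemma restr_free_dual_basis n :
  fin_dual_basis (restr 'rV[A ⊗ B]_n (tensr : B -> A ⊗ B)).
Proof.
pose vb i := (vbasis {:A})`_i; pose co i (a : A) := coord (vbasis {:A}) i a.
have co_bal i : balanced (fun (a : A) (c : k) => c *: a)
    (fun (c : k) (b : B) => c *: b) (fun a b => co i a *: b).
  split=> [a a' b|a b b'|a c b]; rewrite /co.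
  - by rewrite linearD scalerDl.
  - exact: scalerDr.
  - by rewrite linearZ scalerA mulrC.
pose h i (x : A ⊗ B) : B := tens_lift (fun a b => co i a *: b) x.
have hD i x y : h i (x + y) = h i x + h i y by apply: (tens_liftD (co_bal i)).
have hE i a b : h i (tensl a * tensr b) = co i a *: b.
  by rewrite tenslr; apply: (tens_lift_pure (co_bal i)).
have hZ i b x : h i (tensr b * x) = b * h i x.
  elim/tensalg_ind: x => [x y IHx IHy|a b']; first by rewrite mulrDr !hD IHx IHy mulrDr.
  by rewrite mulrA tenslr_comm -mulrA -rmorphM !hE scalerAr.
have phi_exists (t : 'I_(\dim {:A}) * 'I_n) :
    exists phi : {linear restr 'rV[A ⊗ B]_n (tensr : B -> A ⊗ B) -> B^o},
    forall v, phi v = h t.1 ((v : 'rV_n) 0 t.2).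
  by apply: linear_mapP => b v w; rewrite restrZ !mxE hD hZ.
have /choice[phi phiE] := phi_exists.
pose p (t : 'I_(\dim {:A}) * 'I_n) : restr 'rV[A ⊗ B]_n (tensr : B -> A ⊗ B) :=
  tensl (vb t.1) *: delta_mx 0 t.2.
apply: (fin_dual_basis_fintype (p := p) (phi := phi)) => v.
under eq_bigr do rewrite phiE restrZ.
rewrite {1}[v]row_sum_delta.
rewrite -(pair_bigA _ (fun i j => tensr (h i ((v : 'rV_n) 0 j)) *: (tensl (vb i) *: delta_mx 0 j))) /=.
rewrite exchange_big; apply: eq_bigr => j _ /=.
under eq_bigr do rewrite scalerA.
rewrite -scaler_suml; congr (_ *: _).
elim/tensalg_ind: ((v : 'rV_n) 0 j) => [x y IHx IHy|a b].
  by rewrite {1}IHx {1}IHy -big_split; apply: eq_bigr => i _; rewrite hD rmorphD mulrDl.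
rewrite {1}(coord_vbasis (memvf a)) rmorph_sum mulr_suml; apply: eq_bigr => i _ /=.
by rewrite hE tenslr tensrl -/(ta_pure _ _) ta_pureZ.
Qed.

End FreeOverFactor.

(** * The duality Hom_L(X, L) = Hom_A(T X, A) *)

Section HomDuality.

Variables (k : fieldType) (A B : falgType k).

Local Notation BB := (B^o : lmodType B).
Local Notation T X := (AtensV_tens (dualmod BB) X).

Lemma regular_fin_gen (R : pzRingType) : fin_gen (R^o : lmodType R).
Proof.
exists 1%N, (fun=> 1 : R^o) => x; exists (fun=> x).
by rewrite big_ord1 /GRing.scale /= mulr1.
Qed.

Lemma contract_expand m (s : 'I_m -> BB) (sigma : 'I_m -> dualmod BB) :
  dual_pair s sigma -> forall x : A ⊗ B,
  x = \sum_i tensl (contract (sigma i) 1 x) * tensr (s i : B).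
Proof.
move=> s_dual; elim/tensalg_ind=> [x y {1}-> {1}->|a b].
  rewrite -big_split; apply: eq_bigr => i _ /=.
  by rewrite contractD rmorphD mulrDl.
rewrite {1}[b]s_dual rmorph_sum mulr_sumr; apply: eq_bigr => i _ /=.
rewrite contract_pure !tenslr [b *: (1 : BB)]mulr1 ta_pureZ.
by congr ta_pure; rewrite [LHS]mulr_algl.
Qed.

(** Injectivity of A ⊗ B -> Hom_k(D(B), A): an element is rebuilt from its contractions against a
    dual basis of B. *)
Lemma contract_separates (x y : A ⊗ B) :
  (forall beta : dualmod BB, contract beta 1 x = contract beta 1 y) -> x = y.
Proof.
move=> xy; have [m [s [sigma s_dual]]] := dual_pair_exists (regular_fin_gen B).
rewrite (contract_expand s_dual x) (contract_expand s_dual y).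
by apply: eq_bigr => i _; rewrite xy.
Qed.

Lemma hom_to_tensor (Y : lmodType (A ⊗ B)) (f : {linear Y -> (A ⊗ B)^o}) :
  exists g : {linear T Y -> A^o},
    forall beta y, g (tp beta y) = contract beta 1 (f y).
Proof.
apply: tp_lift_linear => [*|*|b beta y|a beta y].
- exact: contractDl.
- by rewrite linearD contractD.
- by rewrite contract_tensr linearZ.
- by rewrite linearZ; apply: contract_tensl.
Qed.

(** The value f y is the element of A ⊗ B whose contractions are prescribed by g; linearity is
    checked after contraction, where B moves from y to beta. *)
Lemma hom_of_tensor (Y : lmodType (A ⊗ B)) (g : {linear T Y -> A^o}) :
  exists f : {linear Y -> (A ⊗ B)^o},
    forall beta y, contract beta 1 (f y) = g (tp beta y).
Proof.
have [m [s [sigma s_dual]]] := dual_pair_exists (regular_fin_gen B).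
pose f (y : Y) : A ⊗ B := \sum_i tensl (g (tp (sigma i) y) : A) * tensr (s i : B).
have fE beta y : contract beta 1 (f y) = g (tp beta y).
  rewrite contract_sum (tp_expand s_dual) linear_sum; apply: eq_bigr => i _.
  by rewrite contract_pure linearZ [_ *: (1 : BB)]mulr1 /= [RHS]mulr_algl.
have [|h hE] := @linear_mapP (A ⊗ B) Y (A ⊗ B)^o f.
  move=> x y z; apply: contract_separates => beta.
  rewrite contractD !fE tpDr linearD; congr (_ + _).
  elim/tensalg_ind: x beta => [x x' IHx IHx'|a b] beta.
    by rewrite !scalerDl tpDr linearD contractD IHx IHx'.
  rewrite -scalerA -tpZ -tp_bal linearZ /= -fE contract_tensr.
  transitivity (contract beta 1 (tensl a * (tensr b * f y))); first exact/esym/contract_tensl.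
  by rewrite mulrA.
by exists h => beta y; rewrite hE fE.
Qed.

Lemma ext_prop_tp_map (X Y : lmodType (A ⊗ B)) (j : {linear X -> Y}) :
  ext_prop (tp_map (V := dualmod BB) j) <-> ext_prop j.
Proof.
split=> j_ext phi.
  have [g gE] := hom_to_tensor phi; have [h hE] := j_ext g.
  have [f fE] := hom_of_tensor h; exists f => x; apply: contract_separates => beta.
  by rewrite fE -gE -hE /= tp_mapE.
have [f fE] := hom_of_tensor phi; have [h hE] := j_ext f.
have [g gE] := hom_to_tensor h; exists g => t.
elim/tp_ind: t => [t u IHt IHu|beta x]; first by rewrite !linearD /= IHt IHu.
by rewrite /= tp_mapE gE hE fE.
Qed.

(** Generators of Hom_A(T X, A) over A correspond to maps U i from X to L, and these are the
    components of f. A functional with coefficients c i is then f followed by right multiplication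
    by the [tensl (c i)]. *)
Lemma free_approximation (X : lmodType (A ⊗ B)) : stable_syzygy (T X) ->
  exists n (f : {linear X -> 'rV[A ⊗ B]_n}), ext_prop f.
Proof.
move=> /stable_syzygy_dual_gen[n [u u_gen]].
have /choice[U UE] i := hom_of_tensor (u i).
have [|f fE] := @linear_mapP (A ⊗ B) X 'rV[A ⊗ B]_n (fun x => \row_i (U i x : A ⊗ B)).
  by move=> a x y; apply/rowP => i; rewrite !mxE linearP.
exists n, f => phi; have [g gE] := hom_to_tensor phi; have [c cE] := u_gen g.
have [|psi psiE] := @linear_mapP (A ⊗ B) 'rV[A ⊗ B]_n (A ⊗ B)^o
    (fun v => \sum_i v 0 i * tensl (c i)).
  move=> a v w; rewrite scaler_sumr -big_split; apply: eq_bigr => i _ /=.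
  by rewrite !mxE mulrDl -mulrA.
exists psi => x; rewrite psiE; apply: contract_separates => beta.
rewrite contract_sum -gE cE; apply: eq_bigr => i _.
by rewrite fE mxE contract_mul_tensl UE.
Qed.

End HomDuality.

(** * The duality Hom_B(Y, N) = D(D(N) ⊗_B Y) *)

Section FunctionalExtension.

Variables (k : fieldType) (A B : falgType k) (N : lmodType B).

Lemma functional_of_hom (Y : lmodType (A ⊗ B)) (phi : {linear restr Y tensr -> N}) :
  exists F : {linear restr (AtensV_tens (dualmod N) Y) (in_alg A) -> k^o},
    forall (beta : dualmod N) y, F (tp beta y) = beta (phi y).
Proof.
have phiZ b (y : Y) : phi (tensr b *: y) = b *: phi y.
  by rewrite -[_ *: y](restrZ _ (y : restr Y tensr)) linearZ.
have [|||F [FD FE]] := @tp_lift_exists k A B (dualmod N) Y k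
    (fun beta y => beta (phi y)).
- by [].
- by move=> beta y z; rewrite (linearD phi) dualD.
- by move=> b beta y; rewrite phiZ.
have [|F' F'E] := @linear_mapP k
    (restr (AtensV_tens (dualmod N) Y) (in_alg A)) k^o F.
  move=> c t u; rewrite FD; congr (_ + _); rewrite restrZ /=.
  elim/tp_ind: t => [t t' IHt IHt'|beta y].
    by rewrite scalerDr !FD IHt IHt' scalerDr.
  by rewrite tpZ tenslr_scalar !FE phiZ dualZ.
by exists F' => beta y; rewrite F'E FE.
Qed.

Hypothesis N_fg : fin_gen N.

Lemma hom_of_functional (Y : lmodType (A ⊗ B))
    (F : {linear restr (AtensV_tens (dualmod N) Y) (in_alg A) -> k^o}) :
  exists phi : {linear restr Y tensr -> N},
    forall (beta : dualmod N) y, beta (phi y) = F (tp beta y).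
Proof.
have [m [s [sigma s_dual]]] := dual_pair_exists N_fg.
pose phi (y : Y) : N := \sum_i (F (tp (sigma i) y) : k)%:A *: s i.
have phiE (beta : dualmod N) y : beta (phi y) = F (tp beta y).
  rewrite dual_sum (tp_expand s_dual).
  have F_sum (G : 'I_m -> AtensV_tens (dualmod N) Y) :
      F (\sum_i G i) = \sum_i F (G i) by rewrite (linear_sum F).
  rewrite F_sum; apply: eq_bigr => i _; rewrite dualZ.
  by rewrite -(restrZ (f := in_alg A) (beta (s i)) (tp (sigma i) y)) linearZ [RHS]mulrC.
have [|h hE] := @linear_mapP B (restr Y tensr) N phi.
  move=> b y z; apply: (dual_separates s_dual) => beta.
  rewrite dualD -[beta (b *: phi y)]/(((b : B^c) *: beta) (phi y)) !phiE.
  by rewrite tpDr (linearD F) tp_bal.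
by exists h => beta y; rewrite hE phiE.
Qed.

(** By duality, extending phi along g means extending F along D(N) ⊗ g; over a field the only
    obstruction is the kernel of that map. *)
Lemma hom_extension (X Y : lmodType (A ⊗ B)) (g : {linear X -> Y})
    (phi : {linear restr X tensr -> N})
    (F : {linear restr (AtensV_tens (dualmod N) X) (in_alg A) -> k^o}) :
  fin_gen (AtensV_tens (dualmod N) Y) ->
  (forall (beta : dualmod N) x, F (tp beta x) = beta (phi x)) ->
  (forall t, tp_map g t = 0 -> F t = 0) ->
  exists psi : {linear restr Y tensr -> N}, forall x, psi (g x) = phi x.
Proof.
move=> TY_fg FE F_ker.
have [Tg TgE] := restr_map_exists (in_alg A) (tp_map (V := dualmod N) g).
have [|t|chi chiE] := functional_factor (g := Tg) (phi := F).
- exact: falg_fin_gen_restr.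
- by rewrite TgE; apply: F_ker.
have [psi psiE] := hom_of_functional chi.
have [m [s [sigma s_dual]]] := dual_pair_exists N_fg.
exists psi => x; apply: (dual_separates s_dual) => beta.
by rewrite psiE -FE -chiE TgE /= tp_mapE.
Qed.

End FunctionalExtension.

(** * Finite generation of submodules, and free resolutions *)

Section Restriction.

Variables (R S : pzRingType) (f : {rmorphism R -> S}).

Lemma fin_gen_of_restr (M : lmodType S) : fin_gen (restr M f) -> fin_gen M.
Proof.
move=> [n [g gE]]; exists n, g => x.
by have [c cE] := gE x; exists (f \o c).
Qed.

Lemma restr_short_exact (K P M : lmodType S) (j : {linear K -> P})
    (e : {linear P -> M}) : short_exact j e ->
  exists (j' : {linear restr K f -> restr P f}) (e' : {linear restr P f -> restr M f}),
    [/\ forall x, j' x = j x, forall x, e' x = e x & short_exact j' e'].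
Proof.
move=> [j_inj je e_surj].
have [j' j'E] := restr_map_exists f j; have [e' e'E] := restr_map_exists f e.
exists j', e'; split=> //; split=> [x y|y|y].
- by rewrite !j'E => /j_inj.
- rewrite e'E; split=> [/je[x <-]|[x <-]]; first by exists x; rewrite j'E.
  by rewrite j'E; apply/je; exists x.
- by have [x <-] := e_surj y; exists x; rewrite e'E.
Qed.

End Restriction.

Lemma fin_dual_basis_fin_gen (R : pzRingType) (P : lmodType R) :
  fin_dual_basis P -> fin_gen P.
Proof. by case/fin_dual_basis_projective. Qed.

Section Noetherian.

Variables (k : fieldType) (A B : falgType k).

Lemma restr_tensr_fin_gen (M : lmodType (A ⊗ B)) :
  fin_gen M -> fin_gen (restr M tensr).
Proof.
move=> [n [g gE]].
have [e' e'E] := restr_map_exists (tensr : B -> A ⊗ B) (row_comb g).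
have [m P_gen] := fin_dual_basis_fin_gen (restr_free_dual_basis A B n).
exists m; apply: (gen_by_surj (e := e')) P_gen => y.
have [c ->] := gE y; exists (\row_i c i : 'rV[A ⊗ B]_n).
by rewrite e'E; apply: eq_bigr => i _; rewrite mxE.
Qed.

Lemma submodule_fin_gen (K M : lmodType (A ⊗ B)) (j : {linear K -> M}) :
  injective j -> fin_gen M -> fin_gen K.
Proof.
move=> j_inj /restr_tensr_fin_gen/falg_fin_gen_restr[m M_gen].
have [j' j'E] := restr_map_exists (tensr : B -> A ⊗ B) j.
have [j'' j''E] := restr_map_exists (in_alg B) j'.
have [|m' [K_gen _ _]] := gen_by_subspace (j := j'') M_gen.
  by move=> x y; rewrite !j''E !j'E => /j_inj.
apply: (@fin_gen_of_restr _ _ (tensr : B -> A ⊗ B)).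
by apply: (@fin_gen_of_restr _ _ (in_alg B)); exists m'.
Qed.

Lemma free_cover (M : lmodType (A ⊗ B)) : fin_gen M ->
  exists n (K : lmodType (A ⊗ B)) (j : {linear K -> 'rV[A ⊗ B]_n})
         (e : {linear 'rV[A ⊗ B]_n -> M}), short_exact j e /\ fin_gen K.
Proof.
move=> [n [g gE]]; have [K [j [j_inj je]]] := kernel_exists (row_comb g).
exists n, K, j, (row_comb g : {linear _ -> _}).
split; first split=> //.
  move=> y; have [c ->] := gE y; exists (\row_i c i).
  by apply: eq_bigr => i _; rewrite mxE.
apply: submodule_fin_gen j_inj _.
exact/fin_dual_basis_fin_gen/row_dual_basis.
Qed.

Lemma free_syzygies (X : lmodType (A ⊗ B)) : fin_gen X ->
  exists (n : nat -> nat) (Y : nat -> lmodType (A ⊗ B))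
         (j : forall i, {linear Y i.+1 -> 'rV[A ⊗ B]_(n i)})
         (e : forall i, {linear 'rV[A ⊗ B]_(n i) -> Y i}),
    Y 0%N = X /\ forall i, short_exact (j i) (e i).
Proof.
move=> X_fg; pose T := {M : lmodType (A ⊗ B) | fin_gen M}.
have cover (M : T) : exists t : {n : nat & {K : T &
    ({linear sval K -> 'rV[A ⊗ B]_n} * {linear 'rV[A ⊗ B]_n -> sval M})%type}},
    short_exact (projT2 (projT2 t)).1 (projT2 (projT2 t)).2.
  case: M => M M_fg; have [n [K [j [e [ses K_fg]]]]] := free_cover M_fg.
  by exists (existT _ n (existT _ (exist _ K K_fg) (j, e))).
pose t M := sval (cid (cover M)).
pose Y i := iter i (fun M => projT1 (projT2 (t M))) (exist _ X X_fg : T).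
exists (fun i => projT1 (t (Y i))), (fun i => sval (Y i)).
exists (fun i => (projT2 (projT2 (t (Y i)))).1).
exists (fun i => (projT2 (projT2 (t (Y i)))).2).
split=> // i; exact: (svalP (cid (cover (Y i)))).
Qed.

Lemma free_resolution (X : lmodType (A ⊗ B)) : fin_gen X ->
  exists (n : nat -> nat)
         (d : forall i, {linear 'rV[A ⊗ B]_(n i.+1) -> 'rV[A ⊗ B]_(n i)})
         (eps : {linear 'rV[A ⊗ B]_(n 0) -> X}),
    projective_resolution (P := fun i => 'rV[A ⊗ B]_(n i)) d eps.
Proof.
move=> /free_syzygies[n [Y [j [e [Y0 ses]]]]]; subst X.
have j_inj i : injective (j i) by case: (ses i).
have je i : exact_at (j i) (e i) by case: (ses i).
have e_surj i y : exists x, e i x = y by case: (ses i).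
have j_ex i (W : zmodType) (h : 'rV[A ⊗ B]_(n i) -> W) :
    exact_at (j i) h -> exact_at (j i \o e i.+1) h.
  move=> jh y; rewrite jh; split=> [[x <-]|[x <-]]; last by exists (e i.+1 x).
  by have [x' <-] := e_surj _ x; exists x'.
exists n, (fun i => j i \o e i.+1), (e 0%N); split.
- by move=> i; have [] := iffLR (fin_dual_basis_projective _) (row_dual_basis (A ⊗ B) (n i)).
- exact: e_surj.
- exact/j_ex/je.
- move=> i; apply: j_ex => y /=; rewrite -je; split=> [|->]; last by rewrite linear0.
  by rewrite -[X in _ = X -> _](linear0 (j i)) => /j_inj.
Qed.

End Noetherian.

(** * Devissage to simple modules *)

Section Devissage.

Variables (k : fieldType) (B : falgType k).

Lemma simple_fin_gen (S : lmodType B) : simple_module S -> fin_gen S.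
Proof.
move=> [[s s0] S_simple].
have [|U0|U_all] := S_simple [pred x | `[< exists b, x = b *: s >]].
- split=> [|a x y]; rewrite !inE; first by apply/asboolP; exists 0; rewrite scale0r.
  move=> /asboolP[b ->] /asboolP[c ->]; apply/asboolP.
  by exists (a * b + c); rewrite scalerDl scalerA.
- by case/eqP: s0; apply: U0; rewrite inE; apply/asboolP; exists 1; rewrite scale1r.
- exists 1%N, (fun=> s) => x.
  by have /asboolP[b ->] := U_all x; exists (fun=> b); rewrite big_ord1.
Qed.

(** Induction on the number of k-generators of N. If N is neither simple nor zero, it has a proper
    nonzero submodule N' with quotient Q. The induced map to Q extends to P and lifts to N by
    projectivity of P; the error lands in N', where induction applies again. *)
Lemma simple_extension (K P : lmodType B) (j : {linear K -> P}) :
  fin_dual_basis P ->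
  (forall (S : lmodType B) (phi : {linear K -> S}), simple_module S ->
     exists psi : {linear P -> S}, forall x, psi (j x) = phi x) ->
  forall (N : lmodType B) (phi : {linear K -> N}), fin_gen N ->
    exists psi : {linear P -> N}, forall x, psi (j x) = phi x.
Proof.
move=> P_db S_ext N phi /falg_fin_gen_restr[m].
elim/ltn_ind: m N phi => m IHm N phi N_gen.
have [/S_ext//|N_nsimple] := pselect (simple_module N).
have [[s0 s0P]|N0] := pselect (exists s : N, s != 0); last first.
  exists \0 => x; apply/eqP; rewrite eq_sym; apply: contraT => phix.
  by case: N0; exists (phi x).
have [U [U_closed [[u uU u0] [w wU]]]] : exists U : {pred N},
    GRing.submod_closed U /\ (exists2 u, u \in U & u != 0) /\ (exists w, w \notin U).
  apply: contrapT => noU; apply: N_nsimple; split; first by exists s0.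
  move=> U U_closed; have [U_all|/existsNP[w /negP wU]] := pselect (forall s, s \in U).
    by right.
  left=> u uU; apply/eqP; apply: contraT => u0.
  by case: noU; exists U; split=> //; split; [exists u|exists w].
have [N' [i [i_inj iU]]] := submodule_exists U_closed.
have [Q [e [e_surj eU]]] := quotient_exists U_closed.
have [i' i'E] := restr_map_exists (in_alg B) i.
have [e' e'E] := restr_map_exists (in_alg B) e.
have [|m1 [N'_gen _ m1m]] := gen_by_subspace (j := i') N_gen.
  by move=> x y; rewrite !i'E => /i_inj.
have {}m1m : (m1 < m)%N.
  apply: m1m; exists w => y; rewrite i'E => yw.
  by case/negP: wU; apply/iU; exists y.
have [||m2 Q_gen m2m] := gen_by_quotient (e := e') N_gen _ u0.
- by move=> y; have [x <-] := e_surj y; exists x; rewrite e'E.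
- by rewrite e'E; apply/eU.
have [h hE] := IHm m2 m2m Q (e \o phi) Q_gen.
have [h0 h0E] := fin_dual_basis_lift h P_db e_surj.
have [|phi1 phi1E] := @linear_lift_inj B N' N K i (phi \- (h0 \o j)) i_inj.
  by move=> x; apply/iU/eU; rewrite /= linearB h0E hE /= subrr.
have [psi1 psi1E] := IHm m1 m1m N' phi1 N'_gen.
exists (h0 \+ (i \o psi1)) => x.
by rewrite /= psi1E phi1E /= addrC subrK.
Qed.

End Devissage.

(** * From Tor vanishing to B-projectivity *)

Section TorVanishing.

Variables (k : fieldType) (A B : falgType k) (X : lmodType (A ⊗ B)).

(** Pull phi back along the cover q of the syzygy K and view it as a functional on D(S) ⊗_B P_1. By
    Tor_1 = 0 the kernel of D(S) ⊗ d_0 is the image of D(S) ⊗ d_1, where the functional vanishes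
    since q d_1 = 0; so it extends to P_0. *)
Lemma Tor_extension (S : lmodType B) (K : lmodType (A ⊗ B)) (n : nat -> nat)
    (d : forall i, {linear 'rV[A ⊗ B]_(n i.+1) -> 'rV[A ⊗ B]_(n i)})
    (eps : {linear 'rV[A ⊗ B]_(n 0) -> X}) (j : {linear K -> 'rV[A ⊗ B]_(n 0)})
    (phi : {linear restr K tensr -> S}) :
  fin_gen S -> Tor_vanishes 1 (AtensV A (dualmod S)) X ->
  projective_resolution (P := fun i => 'rV[A ⊗ B]_(n i)) d eps ->
  injective j -> exact_at j eps ->
  exists psi : {linear restr 'rV[A ⊗ B]_(n 0) tensr -> S},
    forall x, psi (j x) = phi x.
Proof.
move=> S_fg tor res j_inj jeps.
have tor1 := tor _ _ _ res; case: res => _ _ d_eps dd.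
have [|q qE] := linear_lift_inj (h := d 0%N) j_inj.
  by move=> x; apply/jeps/d_eps; exists x.
have [q' q'E] := restr_map_exists (tensr : B -> A ⊗ B) q.
have [F FE] := functional_of_hom (phi \o q').
have TP_fg : fin_gen (AtensV_tens (dualmod S) 'rV[A ⊗ B]_(n 0)).
  have [m [s [sigma s_dual]]] := dual_pair_exists S_fg.
  exact/fin_dual_basis_fin_gen/(tens_free_dual_basis A s_dual).
have [|psi psiE] := hom_extension S_fg TP_fg FE (g := d 0%N).
  move=> t /tor1[u <-] {t}; rewrite -/(tp_map (d 1%N) u).
  elim/tp_ind: u => [u v IHu IHv|beta x]; first by rewrite !linearD IHu IHv addr0.
  rewrite tp_mapE FE /= q'E.
  have -> : q (d 1%N x) = 0.
    by apply: j_inj; rewrite qE linear0; apply/dd; exists x.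
  by rewrite (linear0 phi) dual0.
exists psi => y.
have /d_eps[x xE] : eps (j y) = 0 by apply/jeps; exists y.
have <- : q x = y by apply: j_inj; rewrite qE.
by rewrite qE psiE /= q'E.
Qed.

Lemma Tor_dual_basis : fin_gen X ->
  (forall S : lmodType B, simple_module S -> Tor_vanishes 1 (AtensV A (dualmod S)) X) ->
  fin_dual_basis (restr X (tensr : B -> A ⊗ B)).
Proof.
move=> X_fg tor; have [n [d [eps res]]] := free_resolution X_fg.
have [K [j [j_inj jeps]]] := kernel_exists eps.
have ses : short_exact j eps by split=> //; case: res.
have P_db := restr_free_dual_basis A B (n 0).
have K_fg : fin_gen K.
  apply: submodule_fin_gen j_inj _.
  exact/fin_dual_basis_fin_gen/row_dual_basis.
have [j' [eps' [j'E eps'E ses']]] := restr_short_exact (tensr : B -> A ⊗ B) ses.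
(* Extending the identity of K gives a B-retraction of j, so X is a B-summand of a free L-module. *)
have [||r rE] := @simple_extension _ _ _ _ j' P_db _ (restr K tensr) idfun.
- move=> S phi S_simple.
  have [psi psiE] := Tor_extension phi (simple_fin_gen S_simple) (tor S S_simple)
    res j_inj jeps.
  by exists psi => x; rewrite j'E psiE.
- exact: restr_tensr_fin_gen.
have [s [sE _]] := short_exact_retraction ses' rE.
exact: fin_dual_basis_retract sE P_db.
Qed.

End TorVanishing.

(** * The class of modules closed under both splicing steps *)

Section RelativeGproj.

Variables (k : fieldType) (A B : falgType k).

Local Notation BB := (B^o : lmodType B).
Local Notation T X := (AtensV_tens (dualmod BB) X).
Local Notation rs X := (restr X (tensr : B -> A ⊗ B)).

Definition relative_Gproj (X : lmodType (A ⊗ B)) : Prop :=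
  [/\ fin_gen X, fin_dual_basis (rs X) & stable_syzygy (T X)].

Lemma dual_regular_fin_gen : fin_gen (dualmod BB).
Proof.
have [m [s [sigma s_dual]]] := dual_pair_exists (regular_fin_gen B).
exists m, sigma => beta; exists (fun i => (beta (s i))%:A).
exact: dual_expand s_dual beta.
Qed.

Lemma tens_regular_free n : fin_dual_basis (T 'rV[A ⊗ B]_n).
Proof.
have [m [s [sigma s_dual]]] := dual_pair_exists (regular_fin_gen B).
exact: tens_free_dual_basis s_dual n.
Qed.

(** As M is B-projective, its free cover splits over B, so T K is the kernel of a projective cover
    of T M. *)
Lemma relative_Gproj_left (M : lmodType (A ⊗ B)) : relative_Gproj M ->
  exists (K P : lmodType (A ⊗ B)) (j : {linear K -> P}) (e : {linear P -> M}),
    [/\ short_exact j e, fin_dual_basis P, ext_prop j & relative_Gproj K].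
Proof.
move=> [M_fg M_db TM]; have [n [K [j [e [ses K_fg]]]]] := free_cover M_fg.
have [j' [e' [j'E e'E ses']]] := restr_short_exact (tensr : B -> A ⊗ B) ses.
have [s sE] : exists s : {linear rs M -> rs 'rV[A ⊗ B]_n}, forall x, e' (s x) = x.
  by apply: (fin_dual_basis_lift idfun M_db); case: ses'.
have [r [rjK jrseE]] := short_exact_section ses' sE.
have rj x : r (j x) = x by rewrite -j'E rjK.
have jrse y : y = j (r y) + s (e y) by rewrite -e'E -j'E -jrseE.
have Tses := @tp_map_short_exact k A B (dualmod BB) _ _ _ j e r s ses rj jrse.
exists K, 'rV[A ⊗ B]_n, j, e; split=> //; first exact: row_dual_basis.
  exact/ext_prop_tp_map/(stable_syzygy_ext_prop Tses (tens_regular_free n) TM).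
split=> //; last exact: stable_syzygy_kernel Tses (tens_regular_free n) TM.
exact: fin_dual_basis_retract rjK (restr_free_dual_basis A B n).
Qed.

(* A left approximation f is B-split: each B-map X -> B amounts to a          *)
(* functional on D(B) (x)_B X, which extends along the injective map induced  *)
(* by f.                                                                      *)
Lemma approximation_split (M P : lmodType (A ⊗ B)) (f : {linear M -> P})
    (f' : {linear rs M -> rs P}) :
  fin_gen (T P) -> fin_dual_basis (rs M) -> (forall x, f' x = f x) ->
  injective (tp_map (V := dualmod BB) f) ->
  exists r : {linear rs P -> rs M}, forall x, r (f' x) = x.
Proof.
move=> TP_fg M_db f'E Tf_inj; apply: (ext_prop_extend idfun _ M_db) => phi.
have [F FE] := functional_of_hom phi.
have [|psi psiE] := hom_extension (regular_fin_gen B) TP_fg FE (g := f).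
  move=> t ft; have -> : t = 0 by apply: Tf_inj; rewrite /= ft linear0.
  exact: (linear0 F).
by exists psi => x; rewrite f'E psiE.
Qed.

(** The approximation f from [free_approximation] need not be visibly injective; the B-retraction
    from [approximation_split] shows that it is, and keeps the sequence exact under T. *)
Lemma relative_Gproj_right (M : lmodType (A ⊗ B)) : relative_Gproj M ->
  exists (P N : lmodType (A ⊗ B)) (j : {linear M -> P}) (e : {linear P -> N}),
    [/\ short_exact j e, fin_dual_basis P, ext_prop j & relative_Gproj N].
Proof.
move=> [M_fg M_db TM]; have [n [f f_ext]] := free_approximation TM.
have TP_db := tens_regular_free n.
have Tf_ext := iffRL (ext_prop_tp_map f) f_ext.
have [f' f'E] := restr_map_exists (tensr : B -> A ⊗ B) f.
have [r rfK] := approximation_split (fin_dual_basis_fin_gen TP_db) M_db f'E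
  (stable_syzygy_injective TM Tf_ext).
have [C [e [e_surj fe]]] := cokernel_exists f.
have ses : short_exact f e.
  by split=> // x y fxy; rewrite -[x]rfK -[y in RHS]rfK !f'E fxy.
have [j' [e' [j'E e'E ses']]] := restr_short_exact (tensr : B -> A ⊗ B) ses.
have rjK x : r (j' x) = x by rewrite j'E -f'E rfK.
have [s [esK jrseE]] := short_exact_retraction ses' rjK.
have rj x : r (f x) = x by rewrite -j'E rjK.
have jrse y : y = f (r y) + s (e y) by rewrite -e'E -j'E -jrseE.
have Tses := @tp_map_short_exact k A B (dualmod BB) _ _ _ f e r s ses rj jrse.
exists 'rV[A ⊗ B]_n, C, f, e; split=> //; first exact: row_dual_basis.
split; last exact: stable_syzygy_cokernel Tses TP_db Tf_ext TM.
- have [m P_gen] := fin_dual_basis_fin_gen (row_dual_basis (A ⊗ B) n).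
  by exists m; apply: gen_by_surj e_surj P_gen.
- exact: fin_dual_basis_retract esK (restr_free_dual_basis A B n).
Qed.

End RelativeGproj.

Theorem proposition4p3 (k : fieldType) (A B : falgType k) (X : lmodType (A ⊗ B)) :
  MonL (@Gproj A) X -> Gproj X.
Proof.
move=> [[X_fg X_tor] X_Gproj].
apply: (@Gproj_of_class _ (@relative_Gproj k A B)) => //.
- exact: relative_Gproj_left.
- exact: relative_Gproj_right.
(* The hypothesis with V = D(B) makes T X Gorenstein projective over A. *)
split=> //; last exact/Gproj_stable_syzygy/X_Gproj/dual_regular_fin_gen.
by apply: Tor_dual_basis => // S S_simple; apply: X_tor.
Qed.
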